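(* Let $G=(V,E)$ be an $n$-vertex unweighted, undirected, connected planar graph (with a fixed planar embedding) of diameter $D$. Let $S\subseteq V$ be a set of sources lying consecutively on a single face of the embedding, and let $T\subseteq V$. Then there exists an algorithm that computes a compression of all $S\times T$ distances in $G$ using $\widetilde{O}(|S|^3\cdot D+|T|)$ bits; that is, it computes a bit string $\mathcal{S}$ of that length together with a decoding function $f$ such that $f(\mathcal{S},s,t)=d_G(s,t)$ for every $s\in S$, $t\in T$.
   Context: $d_G(u,v)$ denotes the shortest-path (hop) distance in $G$. ''Lying consecutively on a single face'' means the vertices of $S$ form a contiguous segment of the boundary of one face of the planar embedding. $\widetilde{O}(\cdot)$ hides factors polylogarithmic in $n$. *)

(* Defs.v *)
From mathcomp Require Import all_boot.
Set Implicit Arguments.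
Unset Strict Implicit.
Unset Printing Implicit Defensive.

(* A simple graph on 'I_n with a combinatorial embedding (rotation system):
   [next u v] is the neighbour of [u] that follows [v] in the cyclic order of
   the neighbours of [u].  [next u v] is irrelevant when [v] is not a neighbour
   of [u]. *)
Record embedded_graph (n : nat) := EmbeddedGraph {
  adj : rel 'I_n;
  next : 'I_n -> 'I_n -> 'I_n;
  adj_sym : symmetric adj;
  adj_irr : irreflexive adj;
  next_adj : forall u v, adj u v -> adj u (next u v);
  next_cyclic : forall u v w, adj u v -> adj u w -> fconnect (next u) v w }.

Section EmbeddedGraphs.
Variables (n : nat) (G : embedded_graph n).

Definition connected_graph : Prop := forall u v, connect (adj G) u v.

(* Least k for which there is a k-edge walk from u to v; n if there is none. *)
Definition dist (u v : 'I_n) : nat :=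
  find (fun k => [exists p : k.-tuple 'I_n,
                    path (adj G) u p && (last u p == v)]) (iota 0 n).

Definition diameter : nat := \max_(u < n) \max_(v < n) dist u v.

Definition darts : {set 'I_n * 'I_n} := [set d | adj G d.1 d.2].

Definition face_step (d : 'I_n * 'I_n) : 'I_n * 'I_n := (d.2, next G d.2 d.1).

(* [face_step] permutes the darts; its orbits are the facial walks. *)
Definition faces : {set {set 'I_n * 'I_n}} :=
  [set [set d' | fconnect face_step d d'] | d in darts].

(* The one-vertex graph has no dart, but still has one face. *)
Definition num_faces : nat := maxn 1 #|faces|.

(* Euler's formula |V| + |F| = |E| + 2: for a connected graph, the surface
   determined by the rotation system is the sphere. *)
Definition planar_embedding : Prop := n + num_faces = #|darts|./2 + 2.

(* S is the set of vertices met by k consecutive steps of a facial walk.  Such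
   a walk may revisit a cut vertex, and may go around the whole face.  The
   second case is the trivial facial walk at an isolated vertex. *)
Definition consecutive_on_face (S : {set 'I_n}) : Prop :=
  (exists2 d, d \in darts &
     exists k : nat, S = [set (iter i face_step d).1 | i : 'I_k])
  \/ (exists2 v, (forall w, ~~ adj G v w) & S \subset [set v]).

(* The problem instance as finite data: n, the list of (u, v, next u v) over all
   darts (u, v), and the lists of the elements of S and of T. *)
Definition instance_data (S T : {set 'I_n}) :
    nat * seq (nat * nat * nat) * seq nat * seq nat :=
  (n,
   [seq (val d.1, val d.2, val (next G d.1 d.2)) | d <- enum darts],
   [seq val s | s <- enum S],
   [seq val t | t <- enum T]).

End EmbeddedGraphs.

(* The total recursive functions between data types built from nat, bool,
   products and lists: Kleene's schemes, with the structural recursor of each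
   type, and minimization restricted to searches that always succeed. *)
Inductive computable : forall A B : Type, (A -> B) -> Prop :=
| comp_ext A B (f g : A -> B) : f =1 g -> computable f -> computable g
| comp_id A : computable (fun x : A => x)
| comp_comp A B C (g : B -> C) (f : A -> B) :
    computable g -> computable f -> computable (fun x => g (f x))
| comp_pair A B C (f : A -> B) (g : A -> C) :
    computable f -> computable g -> computable (fun x => (f x, g x))
| comp_fst A B : computable (fun p : A * B => p.1)
| comp_snd A B : computable (fun p : A * B => p.2)
| comp_true A : computable (fun _ : A => true)
| comp_false A : computable (fun _ : A => false)
| comp_if A B (b : A -> bool) (f g : A -> B) :
    computable b -> computable f -> computable g ->
    computable (fun x => if b x then f x else g x)
| comp_zero A : computable (fun _ : A => 0)
| comp_succ : computable S
| comp_natrec A B (f : A -> B) (g : A * nat * B -> B) :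
    computable f -> computable g ->
    computable (fun p : A * nat =>
      nat_rect (fun _ => B) (f p.1) (fun m r => g (p.1, m, r)) p.2)
| comp_nil A B : computable (fun _ : A => @nil B)
| comp_cons A : computable (fun p : A * seq A => p.1 :: p.2)
| comp_listrec A B C (f : A -> B) (g : A * C * seq C * B -> B) :
    computable f -> computable g ->
    computable (fun p : A * seq C =>
      list_rect (fun _ => B) (f p.1) (fun x s r => g (p.1, x, s, r)) p.2)
| comp_min A (f : A * nat -> bool) (ex : forall x, exists m, f (x, m)) :
    computable f -> computable (fun x => ex_minn (ex x)).

(* Main.v *)
Require Import Defs.
From mathcomp Require Import all_boot all_algebra zify.
Set Implicit Arguments.
Unset Strict Implicit.
Unset Printing Implicit Defensive.

(* By Euler's formula every circulation is a combination of face boundaries,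
   which gives a Jordan property: two disjoint connected sets of vertices cannot
   alternate four times along a facial walk.  So a facial
   segment with vertex set S has at most 2 |S| + 1 positions.  As the sets where
   d(., u) - d(., v) is bounded by a constant are connected, that difference does
   not go up, down, up and down along the walk.  Hence, by a Sauer-Shelah
   argument, at most (D + 1) (2 m)^3 different distance vectors to the targets
   occur on a stretch of m positions.  The compression is a decision program with
   one rule for each distance vector on each dyadic stretch of the walk; a rule
   names the vectors on the two halves.  There are O(|S|^3 D) rules, and each
   target stores the name of its vector on the whole walk.  The encoder searches
   for the shortest string that the decoder reads correctly. *)

(** * Computable functions *)

(** Writing out each distance vector would cost a further factor of order [|S|]. Naming a vector by
    its two halves avoids this: the number of vectors on a stretch is bounded by a cubic in its
    length, while the number of stretches only doubles from one level to the next, so the longest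
    stretch dominates the sum. The cube comes from excluding a fourth alternation, the factor
    [D + 1] from the first entry of a vector; the other entries are determined by steps in {-1, 0,
    1}, of two bits each, whence [2 m]. Exhaustive search separates computability from length: the
    walk and the program need only exist, and nothing about the embedding has to be computed. In
    exchange the search must succeed on arbitrary data, even those of no graph. *)

Section Closure.
Variable A : Type.

Lemma computable_fst B C (f : A -> B * C) :
  computable f -> computable (fun x => (f x).1).
Proof. exact: comp_comp (comp_fst B C). Qed.

Lemma computable_snd B C (f : A -> B * C) :
  computable f -> computable (fun x => (f x).2).
Proof. exact: comp_comp (comp_snd B C). Qed.

Lemma computable_succ (f : A -> nat) :
  computable f -> computable (fun x => (f x).+1).
Proof. exact: comp_comp comp_succ. Qed.

Lemma computable_cons B (f : A -> B) (g : A -> seq B) :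
  computable f -> computable g -> computable (fun x => f x :: g x).
Proof. by move=> cf cg; apply: comp_comp (comp_cons B) (comp_pair cf cg). Qed.

Lemma computable_nat_rect B (n : A -> nat) (f : A -> B) (g : A * nat * B -> B) :
  computable n -> computable f -> computable g ->
  computable (fun x => nat_rect (fun=> B) (f x) (fun m r => g (x, m, r)) (n x)).
Proof.
move=> cn cf cg.
exact: comp_comp (comp_natrec cf cg) (comp_pair (comp_id A) cn).
Qed.

Lemma computable_list_rect B C (s : A -> seq C) (f : A -> B)
    (g : A * C * seq C * B -> B) :
  computable s -> computable f -> computable g ->
  computable
    (fun x => list_rect (fun=> B) (f x) (fun c s r => g (x, c, s, r)) (s x)).
Proof.
move=> cs cf cg.
exact: comp_comp (comp_listrec cf cg) (comp_pair (comp_id A) cs).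
Qed.

Lemma computable_andb (b c : A -> bool) :
  computable b -> computable c -> computable (fun x => b x && c x).
Proof.
move=> cb cc; apply: comp_ext (comp_if cb cc (comp_false A)).
by move=> x; case: (b x).
Qed.

Lemma computable_orb (b c : A -> bool) :
  computable b -> computable c -> computable (fun x => b x || c x).
Proof.
move=> cb cc; apply: comp_ext (comp_if cb (comp_true A) cc).
by move=> x; case: (b x).
Qed.

End Closure.

Ltac computable_step :=
  lazymatch goal with
  | |- computable (fun x => x) => apply: comp_id
  | |- computable fst => apply: comp_fst
  | |- computable snd => apply: comp_snd
  | |- computable (fun x => (@?f x, @?g x)) =>
      apply: (@comp_pair _ _ _ f g)
  | |- computable (fun x => (@?f x).1) => apply: (@computable_fst _ _ _ f)
  | |- computable (fun x => (@?f x).2) => apply: (@computable_snd _ _ _ f)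
  | |- computable (fun _ => 0) => apply: comp_zero
  | |- computable (fun _ => true) => apply: comp_true
  | |- computable (fun _ => false) => apply: comp_false
  | |- computable (fun _ => [::]) => apply: comp_nil
  | |- computable (fun x => (@?f x).+1) => apply: (@computable_succ _ f)
  | |- computable (fun x => @?f x :: @?g x) =>
      apply: (@computable_cons _ _ f g)
  | |- computable (fun x => @?b x && @?c x) => apply: (@computable_andb _ b c)
  | |- computable (fun x => @?b x || @?c x) => apply: (@computable_orb _ b c)
  | _ => apply: comp_if
  end.

Lemma computable_pred A (f : A -> nat) :
  computable f -> computable (fun x => (f x).-1).
Proof.
move=> cf.
have cg : computable (fun p : A * nat * nat => p.1.2) by do !computable_step.
apply: comp_ext (computable_nat_rect cf (comp_zero A) cg).
by move=> x /=; case: (f x).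
Qed.

Lemma computable_addn A (f g : A -> nat) :
  computable f -> computable g -> computable (fun x => f x + g x).
Proof.
move=> cf cg.
have cs : computable (fun p : A * nat * nat => p.2.+1) by do !computable_step.
apply: comp_ext (computable_nat_rect cf cg cs).
by move=> x /=; elim: (f x) => //= m ->.
Qed.

Lemma computable_subn A (f g : A -> nat) :
  computable f -> computable g -> computable (fun x => f x - g x).
Proof.
move=> cf cg.
have cs : computable (fun p : A * nat * nat => p.2.-1).
  by apply: computable_pred; do !computable_step.
apply: comp_ext (computable_nat_rect cg cf cs).
by move=> x /=; elim: (g x) => [|m IHm] /=; rewrite ?subn0 // subnS IHm.
Qed.

Lemma computable_eq0 A (f : A -> nat) :
  computable f -> computable (fun x => f x == 0).
Proof.
move=> cf.
apply: comp_ext (computable_nat_rect cf (comp_true A) (comp_false _)).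
by move=> x /=; case: (f x).
Qed.

Lemma computable_leq A (f g : A -> nat) :
  computable f -> computable g -> computable (fun x => f x <= g x).
Proof. by move=> cf cg; apply/computable_eq0/computable_subn. Qed.

Lemma computable_eqn A (f g : A -> nat) :
  computable f -> computable g -> computable (fun x => f x == g x).
Proof.
move=> cf cg; apply: comp_ext
  (computable_andb (computable_leq cf cg) (computable_leq cg cf)).
by move=> x /=; rewrite eqn_leq.
Qed.

Ltac solve_computable :=
  repeat first
  [ assumption
  | lazymatch goal with
    | |- computable (fun x => @?f x <= @?g x) => apply: (@computable_leq _ f g)
    | |- computable (fun x => @?f x == @?g x) => apply: (@computable_eqn _ f g)
    | |- computable (fun x => @?f x + @?g x) => apply: (@computable_addn _ f g)
    end
  | computable_step ].

Lemma computable_foldr A B C (f : A -> B -> C -> C) (s : A -> seq B)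
    (z : A -> C) :
  computable (fun p : A * B * C => f p.1.1 p.1.2 p.2) ->
  computable s -> computable z ->
  computable (fun x => foldr (f x) (z x) (s x)).
Proof.
move=> cf cs cz.
have cg : computable (fun p : A * B * seq B * C => f p.1.1.1 p.1.1.2 p.2).
  apply: (@comp_comp _ (A * B * C)%type _ (fun p => f p.1.1 p.1.2 p.2)
            (fun p : A * B * seq B * C => (p.1.1.1, p.1.1.2, p.2)) cf).
  by solve_computable.
apply: comp_ext (computable_list_rect cs cz cg).
by move=> x /=; elim: (s x) => //= b t ->.
Qed.

Lemma computable_mem A (f : A -> nat) (s : A -> seq nat) :
  computable f -> computable s -> computable (fun x => f x \in s x).
Proof.
move=> cf cs.
apply: comp_ext (computable_foldr (f := fun x y b => (f x == y) || b) _ cs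
                   (comp_false A)).
  by move=> x; elim: (s x) => //= y t ->.
apply: computable_orb; last by solve_computable.
apply: computable_eqn; last by solve_computable.
by apply: comp_comp cf _; solve_computable.
Qed.

Lemma computable_all A B (P : A -> B -> bool) (s : A -> seq B) :
  computable (fun p : A * B => P p.1 p.2) -> computable s ->
  computable (fun x => all (P x) (s x)).
Proof.
move=> cP cs.
apply: comp_ext (computable_foldr (f := fun x y b => P x y && b) _ cs
                   (comp_true A)).
  by move=> x; elim: (s x) => //= y t ->.
apply: computable_andb; last by solve_computable.
apply: (@comp_comp _ (A * B)%type _ (fun p => P p.1 p.2)
          (fun p : A * B * bool => (p.1.1, p.1.2)) cP).
by solve_computable.
Qed.

(** * The decoder *)

Definition registers : Type := nat * nat * nat * nat.

(* The string is a sequence of two-bit tokens, read from right to left, that act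
   on four registers and on an output [p]: in reading order, the tokens
   [false, b] append the binary digit [b] to the first register, [true, false]
   shifts the registers, and [true, true] applies the rule stored in them,
   namely: if [p] is the fourth register, replace it by the second or the first
   one, according to whether the input [q] is less than the third one. *)
Definition exec_token (q : nat) (c b : bool) (st : registers * nat) :
    registers * nat :=
  if c then
    if b then
      (st.1, if st.2 == st.1.2 then
               if q < st.1.1.2 then st.1.1.1.2 else st.1.1.1.1
             else st.2)
    else (0, st.1.1.1.1, st.1.1.1.2, st.1.1.2, st.2)
  else ((if b then (st.1.1.1.1 + st.1.1.1.1).+1
         else st.1.1.1.1 + st.1.1.1.1), st.1.1.1.2, st.1.1.2, st.1.2, st.2).

(* The first component is 0 between two tokens; after the first bit of a token
   it is 1 or 2, according to the value of that bit. *)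
Definition read_bit (q : nat) (b : bool) (st : nat * (registers * nat)) :
    nat * (registers * nat) :=
  if st.1 == 0 then ((if b then 2 else 1), st.2)
  else (0, exec_token q (st.1 == 2) b st.2).

Definition exec_string (str : seq bool) (q p : nat) : nat :=
  (foldr (read_bit q) (0, (0, 0, 0, 0, p)) str).2.2.

(** The string is used twice: key [2 s + 1] yields the position of [s] on the walk, which then
    serves as the input [q] for key [2 t]. Parity separates sources from targets. *)
Definition decode (x : seq bool * nat * nat) : nat :=
  exec_string x.1.1 (exec_string x.1.1 0 (x.1.2 + x.1.2).+1) (x.2 + x.2).

Lemma computable_exec_string A (str : A -> seq bool) (q p : A -> nat) :
  computable str -> computable q -> computable p ->
  computable (fun x => exec_string (str x) (q x) (p x)).
Proof.
move=> cstr cq cp; rewrite /exec_string.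
apply/computable_snd/computable_snd/(computable_foldr (f := fun x => read_bit (q x)));
  [| by solve_computable..].
have cq' : computable
    (fun x : A * bool * (nat * (registers * nat)) => q x.1.1).
  by apply: comp_comp cq _; solve_computable.
by rewrite /read_bit /exec_token; solve_computable.
Qed.

Lemma computable_decode : computable decode.
Proof.
by rewrite /decode; do !apply: computable_exec_string; solve_computable.
Qed.

(** * Distances from the instance data *)

Definition instance : Type := nat * seq (nat * nat * nat) * seq nat * seq nat.

Definition expand (E : seq (nat * nat * nat)) (r : seq nat) : seq nat :=
  foldr (fun e acc => if e.1.1 \in r then e.1.2 :: acc else acc) r E.

Definition ball (E : seq (nat * nat * nat)) (s k : nat) : seq nat :=
  nat_rect (fun=> seq nat) [:: s] (fun _ => expand E) k.

(** Counts the radii [k < n] whose ball about [s] misses [t]. Balls grow with [k], so in a connected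
    graph this count is the distance. *)
Definition data_dist (x : instance) (s t : nat) : nat :=
  nat_rect (fun=> nat) 0
    (fun k acc => if t \in ball x.1.1.2 s k then acc else acc.+1) x.1.1.1.

Lemma computable_ball A (E : A -> seq (nat * nat * nat)) (s k : A -> nat) :
  computable E -> computable s -> computable k ->
  computable (fun x => ball (E x) (s x) (k x)).
Proof.
move=> cE cs ck; rewrite /ball.
apply: (computable_nat_rect (g := fun p => expand (E p.1.1) p.2)) => //.
  by solve_computable.
rewrite /expand; apply: (computable_foldr
  (f := fun (p : A * nat * seq nat) (e : nat * nat * nat) acc =>
          if e.1.1 \in p.2 then e.1.2 :: acc else acc)
  (s := fun p => E p.1.1) (z := snd)).
- by apply: comp_if; [apply: computable_mem|..]; solve_computable.
- by apply: comp_comp cE _; solve_computable.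
- by solve_computable.
Qed.

Lemma computable_data_dist A (x : A -> instance) (s t : A -> nat) :
  computable x -> computable s -> computable t ->
  computable (fun y => data_dist (x y) (s y) (t y)).
Proof.
move=> cx cs ct; rewrite /data_dist.
apply: (computable_nat_rect (g := fun p => if t p.1.1 \in
  ball (x p.1.1).1.1.2 (s p.1.1) p.1.2 then p.2 else p.2.+1));
  try by solve_computable.
have c11 : computable (fun p : A * nat * nat => p.1.1) by solve_computable.
have cx11 := comp_comp cx c11.
have cs11 := comp_comp cs c11.
have ct11 := comp_comp ct c11.
apply: comp_if; try by solve_computable.
by apply: computable_mem => //; apply: computable_ball; solve_computable.
Qed.

(** * The encoder *)

(* Bijective binary numeration: iterating [incr] from the empty string
   enumerates all strings, by nondecreasing size. *)
Fixpoint incr (s : seq bool) : seq bool :=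
  if s is b :: s' then if b then false :: incr s' else true :: s'
  else [:: false].

Definition string_of (m : nat) : seq bool :=
  nat_rect (fun=> seq bool) [::] (fun _ => incr) m.

Definition rank_of (s : seq bool) : nat :=
  foldr (fun (b : bool) m => (b + m.*2).+1) 0 s.

Lemma rank_of_incr s : rank_of (incr s) = (rank_of s).+1.
Proof. by elim: s => //= [[]] s IHs /=; rewrite ?IHs //; lia. Qed.

Lemma rank_of_inj : injective rank_of.
Proof.
elim=> [|b s IHs] [|c t] //= eq_bc.
have [eq_b eq_s] : b = c /\ rank_of s = rank_of t.
  by case: b eq_bc; case: c => /= eq_bc; split=> //; lia.
by rewrite eq_b (IHs t).
Qed.

Lemma string_of_rank s : string_of (rank_of s) = s.
Proof.
apply: rank_of_inj; elim: (rank_of s) => //= m IHm.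
by rewrite rank_of_incr IHm.
Qed.

Lemma size_string_of : {homo (fun m => size (string_of m)) : m k / m <= k}.
Proof.
apply: homo_leq => // [m|m] /=; first exact: leq_trans.
by elim: (string_of m) => // [[]] s IHs /=.
Qed.

Lemma computable_string_of A (m : A -> nat) :
  computable m -> computable (fun x => string_of (m x)).
Proof.
move=> cm; have cincr : computable incr.
  have cg : computable (fun p : seq bool * bool * seq bool * seq bool =>
    if p.1.1.2 then false :: p.2 else true :: p.1.2) by solve_computable.
  have cf : computable (fun _ : seq bool => [:: false]) by solve_computable.
  apply: comp_ext (computable_list_rect (comp_id _) cf cg).
  by elim=> [|[] s IHs] //=; rewrite -IHs.
rewrite /string_of; apply: (computable_nat_rect (g := fun p => incr p.2));
  try by solve_computable.
by apply: comp_comp cincr _; solve_computable.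
Qed.

Definition encodes (x : instance) (str : seq bool) : bool :=
  all (fun s => all (fun t => decode (str, s, t) == data_dist x s t) x.2) x.1.2.

Lemma computable_encodes :
  computable (fun p : instance * nat => encodes p.1 (string_of p.2)).
Proof.
rewrite /encodes.
apply: (computable_all (P := fun (p : instance * nat) s =>
  all (fun t => decode (string_of p.2, s, t) == data_dist p.1 s t) p.1.2));
  last by solve_computable.
apply: (computable_all (P := fun (p : instance * nat * nat) t =>
  decode (string_of p.1.2, p.2, t) == data_dist p.1.1 p.2 t));
  last by solve_computable.
have cstr : computable
    (fun p : instance * nat * nat * nat => string_of p.1.1.2).
  by apply: computable_string_of; solve_computable.
apply: computable_eqn; last by apply: computable_data_dist; solve_computable.
by apply: comp_comp computable_decode _; solve_computable.
Qed.

(** * Programs for the decoder *)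

Definition rule_output (q : nat) (rho : registers) : nat :=
  if q < rho.1.2 then rho.1.1.2 else rho.1.1.1.

Definition apply_rule (q : nat) (rho : registers) (p : nat) : nat :=
  if p == rho.2 then rule_output q rho else p.

(** As in the string, the last rule of the list acts first. *)
Definition run (q p : nat) (P : seq registers) : nat :=
  foldr (apply_rule q) p P.

Fixpoint digits (w m : nat) : seq bool :=
  if w is w'.+1 then [:: odd m, false & digits w' m./2] else [::].

(** A shift is read before each number and clears the first register; the four shifts together
    discard the previous rule. *)
Definition rule_string (w : nat) (rho : registers) (str : seq bool) : seq bool :=
  [:: true, true &
    digits w rho.1.1.1 ++ [:: false, true &
    digits w rho.1.1.2 ++ [:: false, true &
    digits w rho.1.2 ++ [:: false, true &
    digits w rho.2 ++ [:: false, true & str]]]]].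

Definition program_string (w : nat) (P : seq registers) : seq bool :=
  foldr (rule_string w) [::] P.

Lemma size_digits w m : size (digits w m) = w.*2.
Proof. by elim: w m => //= w IHw m; rewrite IHw. Qed.

Lemma size_program_string w P :
  size (program_string w P) = (8 * w + 10) * size P.
Proof.
elim: P => [|rho P IHP]; first by rewrite muln0.
rewrite /= /rule_string; do 5![rewrite /= ?size_cat ?size_digits].
by rewrite IHP; lia.
Qed.

Lemma read_digits q w m r1 r2 r3 p : m < 2 ^ w ->
  foldr (read_bit q) (0, (0, r1, r2, r3, p)) (digits w m) =
  (0, (m, r1, r2, r3, p)).
Proof.
elim: w m => [|w IHw] m; first by rewrite expn0 ltnS leqn0 => /eqP->.
rewrite expnS mul2n => lt_m; rewrite /= IHw; last by lia.
have /= def_m := odd_double_half m; rewrite /read_bit /exec_token /=.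
by case: (odd m) def_m => def_m; congr (_, (_, _, _, _, _)); lia.
Qed.

Lemma exec_program w q p P :
  all (fun rho => [&& rho.1.1.1 < 2 ^ w, rho.1.1.2 < 2 ^ w, rho.1.2 < 2 ^ w
                    & rho.2 < 2 ^ w]) P ->
  exec_string (program_string w P) q p = run q p P.
Proof.
rewrite /exec_string => ltP.
suff [r ->] : exists r, foldr (read_bit q) (0, (0, 0, 0, 0, p))
                          (program_string w P) = (0, (r, run q p P)) by [].
elim: P ltP => [_|rho P IHP /= /andP[/and4P[lt1 lt2 lt3 lt4] /IHP[r def_r]]].
  by exists (0, 0, 0, 0).
exists rho; case: rho r => [[[r1 r2] r3] r4] [[[? ?] ?] ?] in def_r lt1 lt2 lt3 lt4 *.
rewrite /= /rule_string.
do 4![rewrite /= foldr_cat]; rewrite /= def_r /=.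
by do 4![rewrite read_digits //=].
Qed.

Lemma run_cat q p P Q : run q p (P ++ Q) = run q (run q p Q) P.
Proof. exact: foldr_cat. Qed.

Lemma run_notin q p P : p \notin map snd P -> run q p P = p.
Proof.
elim: P => //= rho P IHP; rewrite inE negb_or => /andP[neq_p /IHP->].
by rewrite /apply_rule (negPf neq_p).
Qed.

(** A single rule fires: the keys are distinct, and the output, being no key, survives the rest of
    the table. *)
Lemma run_table q P rho : uniq (map snd P) -> rho \in P ->
  rule_output q rho \notin map snd P -> run q rho.2 P = rule_output q rho.
Proof.
elim: P => //= rho0 P IHP /andP[notin_rho0 uniqP].
rewrite !inE negb_or => /predU1P[->|rhoP] /andP[neq_out notin_out].
  by rewrite run_notin // /apply_rule eqxx.
by rewrite IHP // /apply_rule (negPf neq_out).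
Qed.

Lemma size_undup_map (A B C : eqType) (f : A -> B) (g : A -> C) (s : seq A) :
  {in s &, forall x y, f x = f y -> g x = g y} ->
  size (undup (map g s)) <= size (undup (map f s)).
Proof.
case: s => // x0 s; set s0 := x0 :: s => fg.
pose F z := g (nth x0 s0 (find (fun x => f x == z) s0)).
rewrite -(size_map F); apply: uniq_leq_size; first exact: undup_uniq.
move=> _ /[!mem_undup] /mapP[x xs ->]; apply/mapP.
exists (f x); first by rewrite mem_undup map_f.
have has_x : has (fun y => f y == f x) s0 by apply/hasP; exists x.
by apply/esym/fg; rewrite ?mem_nth -?has_find //; apply/eqP/(nth_find x0 has_x).
Qed.

Section DecisionTree.
Variables (T : seq nat) (M : nat) (h : nat -> nat -> nat) (cnt : nat -> nat).
Hypothesis ltM : forall q t, t \in T -> h q t < M.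

Definition profile (lo len t : nat) : seq nat := [seq h q t | q <- iota lo len].

Hypothesis cntP : forall lo j,
  size (undup [seq profile lo (2 ^ j) t | t <- T]) <= cnt j.

Fixpoint tree_size (j : nat) : nat :=
  if j is j'.+1 then cnt j + (tree_size j').*2 else M.

(* The state [id t] determines the profile of [t] on a block of [2 ^ j]
   positions: a node is a pair of nodes for the two halves of the block, so that
   a node takes a single rule, whatever the length of the block. *)
Lemma decision_tree j lo b : M <= b ->
  exists (P : seq registers) (id : nat -> nat),
    [/\ size P <= tree_size j,
        forall rho, rho \in P ->
          [/\ b <= rho.2 < b + size P, rho.1.2 <= lo + 2 ^ j,
              rho.1.1.2 < b + size P & rho.1.1.1 < b + size P],
        forall t, t \in T -> b <= id t < b + size P,
        forall t t', profile lo (2 ^ j) t = profile lo (2 ^ j) t' -> id t = id t'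
      & forall t q, t \in T -> lo <= q < lo + 2 ^ j ->
          run q (id t) P = h q t].
Proof.
elim: j lo b => [|j IHj] lo b leMb.
  (* At a leaf the state [b + v] stands for the distance [v]. Since [v < M <= b], no distance is a
     state. *)
  pose P : seq registers := [seq (v, v, 0, b + v) | v <- iota 0 M].
  have keysP : map snd P = iota b M.
    by rewrite -map_comp -[in RHS](addn0 b) iotaDl; apply: eq_map.
  have sizeP : size P = M by rewrite size_map size_iota.
  exists P, (fun t => b + h lo t); rewrite sizeP /=; split=> //.
  - by move=> rho /mapP[v]; rewrite mem_iota => lt_v -> /=; split; lia.
  - by move=> t /(ltM lo); lia.
  - by move=> t t' [->].
  move=> t q tT; rewrite expn0 addn1 ltnS -eqn_leq => /eqP<-.
  have lt_h := ltM lo tT.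
  rewrite (@run_table lo P (h lo t, h lo t, 0, b + h lo t)) //.
  - by rewrite keysP iota_uniq.
  - by apply/mapP; exists (h lo t); rewrite // mem_iota.
  - by rewrite keysP mem_iota /rule_output /=; lia.
have [P1 [id1 [sz1 bnd1 rng1 det1 run1]]] := IHj lo b leMb.
have leMb1 : M <= b + size P1 by lia.
have [P2 [id2 [sz2 bnd2 rng2 det2 run2]]] := IHj (lo + 2 ^ j) _ leMb1.
(* Only pairs that occur for some target become nodes; the profile determines the pair, so [cntP]
   bounds their number. *)
pose K : seq (nat * nat) := undup [seq (id1 t, id2 t) | t <- T].
pose b2 := b + size P1 + size P2.
pose P0 : seq registers :=
  [seq ((nth (0, 0) K i).2, (nth (0, 0) K i).1, lo + 2 ^ j, b2 + i)
  | i <- iota 0 (size K)].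
have keysP0 : map snd P0 = iota b2 (size K).
  by rewrite -map_comp -[in RHS](addn0 b2) iotaDl; apply: eq_map.
have sizeP0 : size P0 = size K by rewrite size_map size_iota.
have split_profile t : profile lo (2 ^ j.+1) t =
    profile lo (2 ^ j) t ++ profile (lo + 2 ^ j) (2 ^ j) t.
  by rewrite /profile expnS mul2n -addnn iotaD map_cat.
have det t t' : profile lo (2 ^ j.+1) t = profile lo (2 ^ j.+1) t' ->
    (id1 t, id2 t) = (id1 t', id2 t').
  rewrite !split_profile => /eqP; rewrite eqseq_cat ?size_map ?size_iota //.
  by case/andP=> /eqP/det1-> /eqP/det2->.
have leK : size K <= cnt j.+1.
  apply: leq_trans (cntP lo j.+1).
  by apply: size_undup_map => t t' _ _; apply: det.
have memK t : t \in T -> (id1 t, id2 t) \in K.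
  by move=> tT; rewrite mem_undup; apply/mapP; exists t.
have lt_index t : t \in T -> index (id1 t, id2 t) K < size K.
  by move/memK; rewrite index_mem.
have bndK i : i < size K -> let k := nth (0, 0) K i in k.1 < b2 /\ k.2 < b2.
  move/(mem_nth (0, 0)); rewrite mem_undup => /mapP[t tT ->] /=.
  by have := rng1 t tT; have := rng2 t tT; lia.
have out (P : seq registers) p lb : (forall rho, rho \in P -> lb <= rho.2 < lb + size P) ->
    ~~ (lb <= p < lb + size P) -> p \notin map snd P.
  by move=> bP; apply: contra => /mapP[rho /bP + ->].
(* [P0] acts first and sends the root to a node of one half. The key ranges of the three tables are
   disjoint and lie above all distances, so a finished distance is never rewritten. *)
exists (P2 ++ P1 ++ P0), (fun t => b2 + index (id1 t, id2 t) K).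
rewrite !size_cat sizeP0; split.
- by rewrite /=; lia.
- move=> rho; rewrite !mem_cat => /or3P[/bnd2[]|/bnd1[]|].
  + by rewrite expnS; split; lia.
  + by rewrite expnS; split; lia.
  case/mapP=> i; rewrite mem_iota => /= lt_i ->; have /= [] := bndK i lt_i.
  by rewrite expnS /b2; split; lia.
- by move=> t /lt_index; rewrite /b2; lia.
- by move=> t t' /det->.
move=> t q tT rng_q; rewrite !run_cat.
have := lt_index t tT; set i := index _ K => lt_i.
pose rho : registers := (id2 t, id1 t, lo + 2 ^ j, b2 + i).
have lt1 := rng1 t tT; have lt2 := rng2 t tT.
rewrite (@run_table q P0 rho) //=.
- rewrite /rule_output /=; case: ifP => lt_q.
    rewrite run1 // ?rng_q ?lt_q; last by lia.
    apply: run_notin; apply: (out _ _ (b + size P1)) => [rho' /bnd2[] //|].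
    by have := ltM q tT; lia.
  rewrite (@run_notin _ _ P1); first by rewrite run2 //; move: rng_q; rewrite expnS; lia.
  by apply: (out _ _ b) => [rho' /bnd1[] //|]; lia.
- by rewrite keysP0 iota_uniq.
- apply/mapP; exists i; first by rewrite mem_iota.
  by rewrite nth_index ?memK.
- by rewrite keysP0 mem_iota /rule_output /= /b2; case: ifP => _; lia.
Qed.

End DecisionTree.

(** Keys lie below [2 N], positions in the next [2 ^ j] numbers, and nodes above these. A distance
    may coincide with a key without harm, since the tables of keys act before the tree. *)
Lemma string_exists (SL TL : seq nat) (dd : nat -> nat -> nat) (W : nat -> nat)
    (N M j w : nat) (cnt : nat -> nat) :
    uniq SL -> uniq TL -> {in SL, forall s, s < N} -> {in TL, forall t, t < N} ->
    {subset SL <= map W (iota N.*2 (2 ^ j))} -> M <= N.*2 ->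
    (forall q t, t \in TL -> dd (W q) t < M) ->
    (forall lo i,
      size (undup [seq profile (dd \o W) lo (2 ^ i) t | t <- TL]) <= cnt i) ->
    N.*2 + 2 ^ j + tree_size M cnt j < 2 ^ w ->
  exists str, size str <= (8 * w + 10) * (size SL + size TL + tree_size M cnt j)
    /\ {in SL & TL, forall s t, decode (str, s, t) = dd s t}.
Proof.
move=> uniqS uniqT ltS ltT subS leM ltM cntP lt_w.
have leMb : M <= N.*2 + 2 ^ j by lia.
have [P [id [sizeP bndP rng _ runP]]] :=
  @decision_tree TL M (dd \o W) cnt ltM cntP j N.*2 _ leMb.
pose pos s := N.*2 + index s (map W (iota N.*2 (2 ^ j))).
have rng_pos s : s \in SL -> N.*2 <= pos s < N.*2 + 2 ^ j.
  by move/subS; rewrite -index_mem size_map size_iota /pos; lia.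
have W_pos s : s \in SL -> W (pos s) = s.
  move=> sS; have lt_pos := rng_pos s sS; have inW := subS s sS.
  rewrite -[RHS](nth_index 0 inW) (nth_map 0) ?nth_iota ?size_iota //.
    by move: lt_pos; rewrite /pos ltn_add2l => /andP[].
  by move: lt_pos; rewrite /pos ltn_add2l => /andP[].
pose PS : seq registers := [seq (pos s, pos s, 0, s.*2.+1) | s <- SL].
pose PT : seq registers := [seq (id t, id t, 0, t.*2) | t <- TL].
pose Q := P ++ PT ++ PS.
have keysS : map snd PS = [seq s.*2.+1 | s <- SL] by rewrite -map_comp.
have keysT : map snd PT = [seq t.*2 | t <- TL] by rewrite -map_comp.
exists (program_string w Q); split.
  rewrite size_program_string leq_mul // !size_cat !size_map addnC.
  by rewrite [size TL + _]addnC leq_add.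
have exec q p : exec_string (program_string w Q) q p = run q p Q.
  apply: exec_program; apply/allP=> [[[[r1 r2] r3] r4]]; rewrite !mem_cat.
  case/or3P=> [/bndP[]|/mapP[t tT]|/mapP[s sS]] /=; first by lia.
    by have := ltT t tT; have := rng t tT => + + [-> -> -> ->]; lia.
  by have := ltS s sS; have := rng_pos s sS => + + [-> -> -> ->]; lia.
have notinP p : p < N.*2 + 2 ^ j -> p \notin map snd P.
  by move=> lt_p; apply/mapP=> -[rho /bndP[+ _ _ _] def_p]; rewrite -def_p; lia.
move=> s t sS tT; rewrite /decode /= !exec !run_cat !addnn.
have lt_s := ltS s sS; have lt_t := ltT t tT; have lt_pos := rng_pos s sS.
have -> : run 0 s.*2.+1 PS = pos s.
  apply: (@run_table 0 PS (pos s, pos s, 0, s.*2.+1)).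
  - by rewrite keysS map_inj_uniq // => x y; lia.
  - exact: (map_f (fun s => (pos s, pos s, 0, s.*2.+1))).
  - by rewrite keysS; apply/mapP=> -[x /ltS]; rewrite /rule_output /=; lia.
have -> : run 0 (pos s) PT = pos s.
  by apply: run_notin; rewrite keysT; apply/mapP=> -[x /ltT]; lia.
have -> : run 0 (pos s) P = pos s by apply/run_notin/notinP; lia.
have -> : run (pos s) t.*2 PS = t.*2.
  by apply: run_notin; rewrite keysS; apply/mapP=> -[x _]; lia.
have -> : run (pos s) t.*2 PT = id t.
  apply: (@run_table (pos s) PT (id t, id t, 0, t.*2)).
  - by rewrite keysT map_inj_uniq // => x y; lia.
  - exact: (map_f (fun t => (id t, id t, 0, t.*2))).
  - rewrite keysT; apply/mapP=> -[x /ltT]; have := rng t tT.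
    by rewrite /rule_output /=; lia.
by rewrite runP //= W_pos.
Qed.

(** Minimization demands a search that succeeds on any data. Here the list of sources itself serves
    as the walk, with the trivial bound [size T'] on the number of profiles. *)
Lemma encodable (x : instance) : exists m, encodes x (string_of m).
Proof.
case: x => [[[n E] SL] TL].
pose dd := data_dist (n, E, SL, TL).
pose S' := undup SL; pose T' := undup TL.
(* Positions beyond [S'] read the default source 0, hence [0 :: S']. *)
pose M := (\max_(s <- 0 :: S') \max_(t <- T') dd s t).+1.
pose N := (\max_(s <- S') s + \max_(t <- T') t + M).+1.
pose W q := nth 0 S' (q - N.*2).
have leN : size S' <= 2 ^ size S' by apply/ltnW/ltn_expl.
pose w := N.*2 + 2 ^ size S' + tree_size M (fun=> size T') (size S').
have [|||||||||str [_ strP]] := @string_exists S' T' dd W N M (size S') w (fun=> size T').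
- exact: undup_uniq.
- exact: undup_uniq.
- move=> s sS; apply: (@leq_ltn_trans (\max_(s <- S') s)); last by rewrite /N; lia.
  by apply: (@leq_bigmax_seq _ S' xpredT id).
- move=> t tT; apply: (@leq_ltn_trans (\max_(t <- T') t)); last by rewrite /N; lia.
  by apply: (@leq_bigmax_seq _ T' xpredT id).
- move=> s sS; apply/mapP; exists (N.*2 + index s S').
    by rewrite mem_iota leq_addr ltn_add2l (leq_trans _ leN) ?index_mem.
  by rewrite /W addKn nth_index.
- by rewrite /N; lia.
- move=> q t tT; rewrite ltnS.
  apply: (@leq_trans (\max_(t <- T') dd (W q) t)).
    exact: (@leq_bigmax_seq _ T' xpredT (dd (W q))).
  apply: (@leq_bigmax_seq _ (0 :: S') xpredT
            (fun s => \max_(t <- T') dd s t)) => //.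
  rewrite inE /W; case: (ltnP (q - N.*2) (size S')) => lt_q.
    by rewrite mem_nth ?orbT.
  by rewrite nth_default.
- by move=> lo i; rewrite (leq_trans (size_undup _)) ?size_map.
- exact: ltn_expl.
exists (rank_of str); rewrite string_of_rank.
by apply/allP=> s sS; apply/allP=> t tT; rewrite strP ?mem_undup.
Qed.

Definition encode (x : instance) : seq bool :=
  string_of (ex_minn (encodable x)).

Lemma computable_encode : computable encode.
Proof.
exact/computable_string_of/(comp_min encodable computable_encodes).
Qed.

Lemma encode_correct x : encodes x (encode x).
Proof. by rewrite /encode; case: ex_minnP. Qed.

Lemma encode_shortest x str : encodes x str -> size (encode x) <= size str.
Proof.
move=> enc; rewrite /encode; case: ex_minnP => m _ min_m.
by rewrite -(string_of_rank str) size_string_of // min_m ?string_of_rank.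
Qed.

(** * Counting profiles *)

(** At [r] increasing positions [x] reads [b], [~~ b], [b], ... and [y] reads the opposite bits. A
    family shattering [r] positions contains such a pair, so excluding alternation bounds the VC
    dimension. *)
Fixpoint alternates (b : bool) (r : nat) (x y : seq bool) : bool :=
  if r is r'.+1 then
    match x, y with
    | a :: x', c :: y' =>
        alternates b r x' y' || [&& a == b, c == ~~ b & alternates (~~ b) r' x' y']
    | _, _ => false
    end
  else true.

Lemma alternates0 b x y : alternates b 0 x y.
Proof. by case: x. Qed.

(* The Sauer-Shelah recursion: the first bit splits X into two families of
   shorter strings; an alternation in their intersection can be extended by
   the first bit, so the intersection satisfies the hypothesis for [r - 1]. *)
Lemma alternation_free_size L r (X : seq (seq bool)) : uniq X ->
  {in X, forall x, size x = L} ->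
  (forall b, {in X &, forall x y, ~~ alternates b r.+1 x y}) ->
  size X <= L.+1 ^ r.
Proof.
elim: L r X => [|L IHL] r X uniqX sizeX altX.
  rewrite exp1n; apply: (@uniq_leq_size _ X [:: [::]]) => // x /sizeX/size0nil->.
  exact: mem_head.
pose Xb b := [seq behead x | x <- X & head false x == b].
have memXb b x : (x \in Xb b) = (b :: x \in X).
  apply/mapP/idP => [[z]|bxX]; last by exists (b :: x); rewrite ?mem_filter /= ?eqxx.
  rewrite mem_filter => /andP[/eqP<- zX] ->.
  by move: zX (sizeX _ zX); case: z.
have uniqXb b : uniq (Xb b).
  rewrite map_inj_in_uniq ?filter_uniq // => x y; rewrite !mem_filter.
  move=> /andP[/eqP hx xX] /andP[/eqP hy yX].
  move: (sizeX x xX) (sizeX y yX) hx hy.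
  by case: x {xX} => // ? ? _; case: y {yX} => // ? ? _ /= -> -> ->.
have sizeXb : size X = size (Xb true) + size (Xb false).
  rewrite !size_map !size_filter -(count_predC (fun x => head false x == true) X).
  by congr (_ + _); apply: eq_count => x /=; case: head.
pose U := undup (Xb true ++ Xb false).
pose I := [seq x <- Xb true | x \in Xb false].
have sizeUI : size X = size U + size I.
  rewrite sizeXb /U undup_cat size_cat !undup_id // !size_filter.
  by rewrite addnAC addnC [in RHS]addnC; congr (_ + _); rewrite addnC count_predC.
have memU x : x \in U -> exists b, b :: x \in X.
  by rewrite mem_undup mem_cat !memXb => /orP[]; [exists true | exists false].
have memI x b : x \in I -> b :: x \in X.
  by rewrite mem_filter !memXb => /andP[]; case: b.
have leU : size U <= L.+1 ^ r.
  apply: IHL => [|x /memU[b /sizeX[]] //|b x y]; first exact: undup_uniq.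
  move=> /memU[a axX] /memU[c cyX]; apply: contra (altX b _ _ axX cyX) => /=.
  by move->.
have sizeI x : x \in I -> size x = L by move/memI=> /(_ true)/sizeX[].
case: r => [|r] in altX leU *.
  suff I0 : I = [::] by rewrite sizeUI I0 addn0.
  case defI: I => [|x I'] //; have xI : x \in I by rewrite defI mem_head.
  have := altX true _ _ (memI x true xI) (memI x false xI).
  by rewrite /= alternates0 orbT.
have leI : size I <= L.+1 ^ r.
  apply: IHL => // [|b x y xI yI]; first by rewrite filter_uniq.
  apply: contra (altX (~~ b) _ _ (memI x (~~ b) xI) (memI y b yI)) => alt.
  by rewrite /= negbK !eqxx orbC andbC /= alt.
rewrite sizeUI (leq_trans (leq_add leU leI)) // expnS addnC -mulSn expnS leq_mul //.
by have [->|r_gt0] := posnP r; rewrite ?expn0 ?leq_exp2r.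
Qed.

Section Profiles.
Variables (T : seq nat) (M : nat) (h : nat -> nat -> nat).
Hypothesis ltM : forall q t, t \in T -> h q t < M.
Hypothesis step : forall q t,
  t \in T -> h q t <= (h q.+1 t).+1 /\ h q.+1 t <= (h q t).+1.

(** The difference [h . t - h . u] increases from [q] to [q.+1], written without truncated
    subtraction. *)
Definition steeper (t u q : nat) : bool := h q t + h q.+1 u < h q.+1 t + h q u.

Hypothesis no_alternation : {in T &, forall t u i1 i2 i3 i4,
  i1 < i2 -> i2 < i3 -> i3 < i4 ->
  ~~ [&& steeper t u i1, steeper u t i2, steeper t u i3 & steeper u t i4]}.

(** Two threshold bits encode a step in {-1, 0, 1}. Where [t] has bit 1 and [u] has bit 0, the step
    of [t] is the larger one; this turns alternating bits into alternating steepness. *)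
Fixpoint step_bits (lo len t : nat) : seq bool :=
  if len is len'.+1 then
    [:: h lo t <= h lo.+1 t, h lo t < h lo.+1 t & step_bits lo.+1 len' t]
  else [::].

(** Positions grow only weakly, because the two bits of a step share a position. Equality is
    excluded afterwards: [steeper t u] and [steeper u t] cannot hold together. *)
Fixpoint steeper_chain (t u : nat) (b : bool) (r lo : nat) : Prop :=
  if r is r'.+1 then
    exists i, [/\ lo <= i, if b then steeper t u i else steeper u t i
                & steeper_chain t u (~~ b) r' i]
  else True.

Lemma steeper_chain_leq t u b r lo lo' :
  lo <= lo' -> steeper_chain t u b r lo' -> steeper_chain t u b r lo.
Proof.
case: r => // r le_lo [i [le_i up_i ch_i]].
by exists i; split=> //; apply: leq_trans le_i.
Qed.

Lemma alternates_chain t u b r lo len :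
  alternates b r (step_bits lo len t) (step_bits lo len u) ->
  steeper_chain t u b r lo.
Proof.
have add_bit x y X Y l l' : l <= l' ->
    (forall b', x = b' -> y = ~~ b' ->
       if b' then steeper t u l else steeper u t l) ->
    (forall b' r', alternates b' r' X Y -> steeper_chain t u b' r' l') ->
    forall b' r', alternates b' r' (x :: X) (y :: Y) ->
      steeper_chain t u b' r' l.
  move=> le_l up chXY b' [|r'] //= /orP[/chXY|/and3P[/eqP xb /eqP yb /chXY]].
    exact: steeper_chain_leq.
  by move=> ch; exists l; split; [|exact: up|exact: steeper_chain_leq ch].
elim: len lo b r => [|len IHlen] lo b r; first by case: r.
apply: (add_bit _ _ _ _ lo lo) => // [[] /= le1 le2|].
- by rewrite /steeper; lia.
- by rewrite /steeper; lia.
apply: (add_bit _ _ _ _ lo lo.+1) => // [[] /= le1 le2|b' r' /IHlen//].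
- by rewrite /steeper; lia.
- by rewrite /steeper; lia.
Qed.

Lemma step_bits_no_alternation lo len b :
  {in T &, forall t u,
     ~~ alternates b 4 (step_bits lo len t) (step_bits lo len u)}.
Proof.
move=> t u tT uT; apply/negP=> /alternates_chain.
case=> i1 [_ up1 [i2 [le12 up2 [i3 [le23 up3 [i4 [le34 up4 _]]]]]]].
have lt_i i j : i <= j -> (steeper t u i && steeper u t j) ||
    (steeper u t i && steeper t u j) -> i < j.
  rewrite leq_eqVlt => /predU1P[<-|//]; rewrite /steeper; lia.
have lt12 : i1 < i2 by apply: lt_i => //; case: b up1 up2 {up3 up4} => /= -> ->; rewrite ?orbT.
have lt23 : i2 < i3 by apply: lt_i => //; case: b up2 up3 {up1 up4} => /= -> ->; rewrite ?orbT.
have lt34 : i3 < i4 by apply: lt_i => //; case: b up3 up4 {up1 up2} => /= -> ->; rewrite ?orbT.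
case: b up1 up2 up3 up4 => /= up1 up2 up3 up4.
  by have := no_alternation tT uT lt12 lt23 lt34; rewrite up1 up2 up3 up4.
by have := no_alternation uT tT lt12 lt23 lt34; rewrite up1 up2 up3 up4.
Qed.

Lemma size_step_bits lo len t : size (step_bits lo len t) = len.*2.
Proof. by elim: len lo => //= len IHlen lo; rewrite IHlen. Qed.

Lemma profile_step_bits lo len : {in T &, forall t u,
  h lo t = h lo u -> step_bits lo len t = step_bits lo len u ->
  profile h lo len.+1 t = profile h lo len.+1 u}.
Proof.
move=> t u tT uT; elim: len lo => [|len IHlen] lo eq_lo /=.
  by rewrite /profile /= eq_lo.
case=> eq_le eq_lt /IHlen IH; rewrite /profile /= eq_lo; congr (_ :: _).
apply: IH; have [] := step lo tT; have [] := step lo uT.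
by lia.
Qed.

Lemma profile_count lo len :
  size (undup [seq profile h lo len.+1 t | t <- T]) <= M * len.*2.+1 ^ 3.
Proof.
pose sig t := (h lo t, step_bits lo len t).
apply: (@leq_trans (size (undup (map sig T)))).
  by apply: size_undup_map => t u tT uT [eq_h eq_b]; apply: profile_step_bits.
pose X := undup [seq step_bits lo len t | t <- T].
have leX : size X <= len.*2.+1 ^ 3.
  apply: alternation_free_size => [|x|b x y]; first exact: undup_uniq.
    by rewrite mem_undup => /mapP[t _ ->]; rewrite size_step_bits.
  rewrite !mem_undup => /mapP[t tT ->] /mapP[u uT ->].
  exact: step_bits_no_alternation.
apply: (@leq_trans (M * size X)); last by rewrite leq_mul.
rewrite -{1}(size_iota 0 M) -(size_allpairs pair).
apply: uniq_leq_size; first exact: undup_uniq.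
move=> _ /[!mem_undup] /mapP[t tT ->].
apply: allpairs_f; first by rewrite mem_iota ltM.
by rewrite mem_undup map_f.
Qed.

End Profiles.

(** * Distances in a connected graph *)

Section Distances.
Variables (n : nat) (G : embedded_graph n).
Hypothesis G_conn : connected_graph G.

Lemma dist_leq_size u p : path (adj G) u p -> dist G u (last u p) <= size p.
Proof.
move=> Gp; rewrite leqNgt; apply/negP=> lt_p.
have lt_n : size p < n.
  by rewrite (leq_trans lt_p) // -[leqRHS](size_iota 0) find_size.
have /negP[] := negbT (before_find 0 lt_p).
by rewrite nth_iota //; apply/existsP; exists (in_tuple p); rewrite /= Gp /=.
Qed.

Lemma has_dist u v :
  has (fun k => [exists p : k.-tuple 'I_n,
         path (adj G) u p && (last u p == v)]) (iota 0 n).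
Proof.
have /connectP[p Gp ->] := G_conn u v.
case: (shortenP Gp) => p' Gp' uniq_p' _; apply/hasP; exists (size p').
  rewrite mem_iota /= add0n -[ltnRHS]card_ord.
  by rewrite -[(size p').+1]/(size (u :: p')) -(card_uniqP uniq_p') max_card.
by apply/existsP; exists (in_tuple p'); rewrite Gp' /=.
Qed.

Lemma dist_ltn u v : dist G u v < n.
Proof. by have := has_dist u v; rewrite has_find size_iota. Qed.

Lemma shortest_path u v :
  exists p, [/\ path (adj G) u p, last u p = v & size p = dist G u v].
Proof.
have := nth_find 0 (has_dist u v); rewrite -/(dist G u v) nth_iota ?dist_ltn // add0n.
by case/existsP=> p /andP[Gp /eqP lp]; exists p; rewrite size_tuple.
Qed.

Lemma dist_leq_diameter u v : dist G u v <= diameter G.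
Proof.
apply: leq_trans (leq_bigmax (F := fun u => \max_(v < n) dist G u v) u).
exact: (leq_bigmax (F := dist G u) v).
Qed.

Lemma dist0 u : dist G u u = 0.
Proof. by apply/eqP; rewrite -leqn0 (@dist_leq_size u [::]). Qed.

Lemma dist_triangle v u w : dist G u w <= dist G u v + dist G v w.
Proof.
have [p [Gp <- <-]] := shortest_path u v.
have [q [Gq <- <-]] := shortest_path (last u p) w.
by rewrite -last_cat -size_cat dist_leq_size // cat_path Gp.
Qed.

Lemma reverse_path u p : path (adj G) u p ->
  exists q, [/\ path (adj G) (last u p) q, last (last u p) q = u
              & u :: p =i last u p :: q].
Proof.
move=> Gp; exists (rev (belast u p)); split.
- by rewrite rev_path; apply: sub_path Gp => x y; rewrite adj_sym.
- by case: p {Gp} => //= v p; rewrite rev_cons last_rcons.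
- by move=> x; rewrite -rev_rcons mem_rev -lastI.
Qed.

Lemma dist_adj u v w : adj G u v -> dist G u w <= (dist G v w).+1.
Proof.
move=> uv; apply: leq_trans (dist_triangle v u w) _.
by rewrite -add1n leq_add2r (@dist_leq_size u [:: v]) /= ?uv.
Qed.

Lemma geodesic_vertex u v p y : path (adj G) u p -> last u p = v ->
  size p = dist G u v -> y \in u :: p -> dist G u y + dist G y v <= dist G u v.
Proof.
move=> Gp lp <- yp; case/splitPl: yp Gp lp => p1 p2 lp1.
rewrite cat_path last_cat lp1 => /andP[Gp1 Gp2] lp2.
by rewrite size_cat -{1}lp1 -lp2 leq_add ?dist_leq_size.
Qed.

(* The sets [{x | d(x, u) - d(x, v) <= l - k}] induce connected subgraphs: a
   shortest path from x to u does not leave them. *)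
Definition level (u v : 'I_n) (k l : nat) (x : 'I_n) : bool :=
  dist G x u + k <= l + dist G x v.

Lemma level_connected u v k l x y : level u v k l x -> level u v k l y ->
  exists p, [/\ path (adj G) x p, last x p = y
              & {in x :: p, forall z, level u v k l z}].
Proof.
have to_u z : level u v k l z ->
    exists p, [/\ path (adj G) z p, last z p = u
                & {in z :: p, forall z', level u v k l z'}].
  move=> lev_z; have [p [Gp lp sz]] := shortest_path z u; exists p; split=> //.
  move=> z' /(geodesic_vertex Gp lp sz); have := dist_triangle z' z v.
  by move: lev_z; rewrite /level; lia.
move=> /to_u[p [Gp lp lev_p]] /to_u[q [Gq lq lev_q]].
have [q' [Gq' lq' mem_q']] := reverse_path Gq.
exists (p ++ q'); rewrite cat_path last_cat lp -{1}lq Gp Gq' -{1}lq lq'.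
split=> // z; rewrite -cat_cons mem_cat => /orP[/lev_p//|zq'].
by apply: lev_q; rewrite mem_q' inE zq' orbT.
Qed.

Definition crossing (x1 x2 x3 x4 : 'I_n) : Prop :=
  forall p q, path (adj G) x1 p -> last x1 p = x3 ->
    path (adj G) x2 q -> last x2 q = x4 ->
    exists2 y, y \in x1 :: p & y \in x2 :: q.

(** The complement of a sublevel set of [d(., u) - d(., v)] is a sublevel set of the opposite
    difference; so both are connected, and walks inside them cannot meet. *)
Lemma crossing_level x1 x2 x3 x4 u v k l : crossing x1 x2 x3 x4 ->
  ~~ [&& level u v k l x1, ~~ level u v k l x2, level u v k l x3
       & ~~ level u v k l x4].
Proof.
move=> cross; apply/negP=> /and4P[lev1 lev2 lev3 lev4].
have levN x : level v u l.+1 k x = ~~ level u v k l x by rewrite /level; lia.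
have [p [Gp lp lev_p]] := level_connected lev1 lev3.
rewrite -!levN in lev2 lev4.
have [q [Gq lq lev_q]] := level_connected lev2 lev4.
have [y /lev_p lev_y /lev_q] := cross p q Gp lp Gq lq.
by rewrite levN lev_y.
Qed.

Definition up (w : nat -> 'I_n) (u v : 'I_n) (i : nat) : bool :=
  dist G (w i) u + dist G (w i.+1) v < dist G (w i.+1) u + dist G (w i) v.

(* If d(., u) - d(., v) goes up, down, up and down along [w], then it takes values
   s < M1 > m < M2 > e in this order; one of the thresholds max(s, m) and
   max(m, e) separates four of them in an alternating way. *)
Lemma crossing_no_alternation (w : nat -> 'I_n) u v i1 i2 i3 i4 :
    (forall j1 j2 j3 j4, j1 <= j2 -> j2 <= j3 -> j3 <= j4 ->
       crossing (w j1) (w j2) (w j3) (w j4)) ->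
    i1 < i2 -> i2 < i3 -> i3 < i4 ->
  ~~ [&& up w u v i1, up w v u i2, up w u v i3 & up w v u i4].
Proof.
move=> cross lt12 lt23 lt34; apply/negP; case/and4P.
have max_pos i j : i <= j -> exists k, [/\ i <= k <= j,
    dist G (w i) u + dist G (w k) v <= dist G (w k) u + dist G (w i) v &
    dist G (w j) u + dist G (w k) v <= dist G (w k) u + dist G (w j) v].
  move=> le_ij; case: (leqP (dist G (w i) u + dist G (w j) v)
                            (dist G (w j) u + dist G (w i) v)) => cmp.
    by exists j; split; rewrite ?le_ij ?leqnn.
  by exists i; split; rewrite ?le_ij ?leqnn //; lia.
have min_pos i j : i <= j -> exists k, [/\ i <= k <= j,
    dist G (w k) u + dist G (w i) v <= dist G (w i) u + dist G (w k) v &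
    dist G (w k) u + dist G (w j) v <= dist G (w j) u + dist G (w k) v].
  move=> le_ij; case: (leqP (dist G (w i) u + dist G (w j) v)
                            (dist G (w j) u + dist G (w i) v)) => cmp.
    by exists i; split; rewrite ?le_ij ?leqnn //; lia.
  by exists j; split; rewrite ?le_ij ?leqnn //; lia.
(* [lt12] is read as [i1.+1 <= i2]: the first peak is sought after the ascent at [i1] and no later
   than the start of the descent at [i2]. *)
have [k1 [/andP[le1 le1'] M1a M1b]] := max_pos _ _ lt12.
have [k2 [/andP[le2 le2'] ma mb]] := min_pos _ _ lt23.
have [k3 [/andP[le3 le3'] M2a M2b]] := max_pos _ _ lt34.
rewrite /up => up1 up2 up3 up4.
have le01 : i1 <= k1 by lia.
have le12 : k1 <= k2 by lia.
have le23 : k2 <= k3 by lia.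
have le34 : k3 <= i4.+1 by lia.
have cross0 := crossing_level _ _ _ _ (cross _ _ _ _ le01 le12 le23).
have cross1 := crossing_level _ _ _ _ (cross _ _ _ _ le12 le23 le34).
(* [c1] and [c2] cut s, M1, m, M2 at s and at m, with sublevel sets; [c3] and [c4] cut M1, m, M2, e
   just above m and just above e, with superlevel sets. *)
have c1 := cross0 u v (dist G (w i1) v) (dist G (w i1) u).
have c2 := cross0 u v (dist G (w k2) v) (dist G (w k2) u).
have c3 := cross1 v u (dist G (w k2) u).+1 (dist G (w k2) v).
have c4 := cross1 v u (dist G (w i4.+1) u).+1 (dist G (w i4.+1) v).
by rewrite /level in c1 c2 c3 c4; lia.
Qed.

Lemma data_dist_correct (S T : {set 'I_n}) (s t : 'I_n) :
  data_dist (instance_data G S T) s t = dist G s t.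
Proof.
pose E := [seq (val d.1, val d.2, val (Defs.next G d.1 d.2)) | d <- enum (darts G)].
have memE e : e \in E -> exists x y : 'I_n,
    [/\ adj G x y, e.1.1 = x & e.1.2 = y].
  by case/mapP=> -[x y]; rewrite mem_enum inE /= => xy ->; exists x, y.
have memEadj (x y : 'I_n) : adj G x y -> exists2 e, e \in E & e.1.1 = x /\ e.1.2 = y.
  move=> xy; exists (val x, val y, val (Defs.next G x y)) => //.
  by apply/mapP; exists (x, y); rewrite ?mem_enum ?inE.
have mem_expand r z : (z \in expand E r) =
    (z \in r) || has (fun e => (e.1.1 \in r) && (e.1.2 == z)) E.
  rewrite /expand; elim: E {memE memEadj} => [|e E' IH] /=; first by rewrite orbF.
  case: ifP => _ /=; last exact: IH.
  by rewrite inE IH eq_sym orbCA.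
have ballP k z : (z \in ball E s k) ->
    exists2 y : 'I_n, z = y & dist G s y <= k.
  elim: k z => [|k IHk] z /=; first by rewrite inE => /eqP->; exists s; rewrite ?dist0.
  rewrite mem_expand => /orP[/IHk[y -> le_y]|/hasP[e /memE[x [y [xy -> ->]]]]].
    by exists y; rewrite ?(leq_trans le_y).
  case/andP=> /IHk[x' /val_inj<- le_x] /eqP<-; exists y => //.
  rewrite (leq_trans (dist_triangle x s y)) // -addn1 leq_add //.
  by rewrite (@dist_leq_size x [:: y]) /= ?xy.
have mem_ball k (y : 'I_n) : dist G s y <= k -> val y \in ball E s k.
  have [p [Gp <- <-]] := shortest_path s y; elim/last_ind: p k Gp => [|p z IHp] k /=.
    move=> _ _; elim: k => [|k IHk] /=; first by rewrite mem_head.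
    by rewrite mem_expand IHk.
  rewrite rcons_path last_rcons size_rcons => /andP[Gp pz].
  case: k => // k /(IHp k Gp) memp /=; rewrite mem_expand; apply/orP; right.
  have [e eE [e1 e2]] := memEadj _ _ pz; apply/hasP; exists e => //.
  by rewrite e1 e2 memp /=.
have memB k : (val t \in ball E s k) = (dist G s t <= k).
  by apply/idP/idP => [/ballP[y /val_inj<-]|/mem_ball].
suff sum_k k : nat_rect (fun=> nat) 0
    (fun m acc => if val t \in ball E s m then acc else acc.+1) k =
    minn k (dist G s t).
  by rewrite /data_dist /instance_data /= sum_k (minn_idPr (ltnW (dist_ltn s t))).
elim: k => [|k /= ->]; first by rewrite min0n.
by rewrite memB; case: (leqP (dist G s t) k); lia.
Qed.

End Distances.

(** * Facial walks *)

Section Faces.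
Variables (n : nat) (G : embedded_graph n).
Implicit Types d e : 'I_n * 'I_n.

Definition reverse d : 'I_n * 'I_n := (d.2, d.1).

Lemma reverseK : involutive reverse.
Proof. by case. Qed.

Lemma mem_reverse d : (reverse d \in darts G) = (d \in darts G).
Proof. by rewrite !inE adj_sym. Qed.

(** Cyclicity makes [next G u] surjective on the finite set of neighbours of [u]. *)
Lemma next_inj u : {in adj G u &, injective (Defs.next G u)}.
Proof.
pose N := [set v | adj G u v].
suff inj : {in N &, injective (Defs.next G u)}.
  by move=> v w uv uw; apply: inj; rewrite inE.
have iterN k v : adj G u v -> adj G u (iter k (Defs.next G u) v).
  by move=> uv; elim: k => //= k IHk; apply: next_adj.
apply/imset_injP/eqP/eq_card=> w; apply/imsetP/idP => [[v]|].
  by rewrite !inE => uv ->; apply: next_adj.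
rewrite inE => uw; have con := next_cyclic (next_adj uw) uw.
exists (iter (findex (Defs.next G u) (Defs.next G u w) w) (Defs.next G u) w).
  by rewrite inE iterN.
by rewrite -iterS iterSr iter_findex.
Qed.

(* [face_step] need not be injective outside the darts. *)
Definition face_perm d : 'I_n * 'I_n :=
  if d \in darts G then face_step G d else d.

Lemma face_step_dart d : d \in darts G -> face_step G d \in darts G.
Proof. by rewrite !inE /= => uv; apply: next_adj; rewrite adj_sym. Qed.

Lemma face_perm_dart d : (face_perm d \in darts G) = (d \in darts G).
Proof. by rewrite /face_perm; case: ifP => // dG; rewrite face_step_dart. Qed.

Lemma face_perm_inj : injective face_perm.
Proof.
move=> d e eq_de; have := face_perm_dart d; rewrite eq_de face_perm_dart => eqG.
move: eq_de; rewrite /face_perm -eqG; case: ifP => // dG.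
move: eqG; rewrite dG; case: d e dG => [u v] [u' v'] /[!inE] /= uv uv'.
move=> [eq_v eq_next]; rewrite -eq_v in uv eq_next *.
by congr (_, _); apply: next_inj eq_next; rewrite -topredE /= adj_sym.
Qed.

Lemma iter_face_step i d : d \in darts G ->
  iter i (face_step G) d = iter i face_perm d.
Proof.
move=> dG; elim: i => //= i ->; rewrite /face_perm.
suff -> : iter i face_perm d \in darts G by [].
by elim: i => //= i IHi; rewrite face_perm_dart.
Qed.

Lemma iter_face_perm_dart i d : d \in darts G -> iter i face_perm d \in darts G.
Proof. by move=> dG; elim: i => //= i; rewrite face_perm_dart. Qed.

Lemma fconnect_face_step d e : d \in darts G ->
  fconnect (face_step G) d e = fconnect face_perm d e.
Proof.
move=> dG; apply/idP/idP => [/iter_findex <-|/iter_findex <-].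
  by rewrite iter_face_step // fconnect_iter.
by rewrite -iter_face_step // fconnect_iter.
Qed.

Lemma facesP X d : X \in faces G -> d \in X ->
  d \in darts G /\ X = [set e | fconnect face_perm d e].
Proof.
case/imsetP=> d0 d0G ->; rewrite inE fconnect_face_step // => con; split.
  by rewrite -(iter_findex con) iter_face_perm_dart.
apply/setP=> e; rewrite !inE fconnect_face_step //.
by rewrite (same_connect (fconnect_sym face_perm_inj) con).
Qed.

Lemma face_in_faces d : d \in darts G ->
  [set e | fconnect face_perm d e] \in faces G.
Proof.
move=> dG; apply/imsetP; exists d => //.
by apply/setP=> e; rewrite !inE fconnect_face_step.
Qed.

Lemma mem_face_perm X d : X \in faces G -> (face_perm d \in X) = (d \in X).
Proof.
case/imsetP=> d0 d0G ->; rewrite !inE !fconnect_face_step //.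
by rewrite -(same_fconnect1_r face_perm_inj).
Qed.

(* The darts at [q] can be enumerated by crossing an edge and then following
   the facial walk. *)
Definition steady (V : eqType) (b : 'I_n * 'I_n -> V) (q : 'I_n) : Prop :=
  forall d, d \in darts G -> d.1 = q ->
    b (reverse d) = b d /\ b (face_perm (reverse d)) = b (reverse d).

Lemma steady_at (V : eqType) (b : 'I_n * 'I_n -> V) q v w :
  steady b q -> adj G q v -> adj G q w -> b (q, v) = b (q, w).
Proof.
move=> st qv qw; rewrite -(iter_findex (next_cyclic qv qw)).
elim: findex => //= k IHk.
have qk : adj G q (iter k (Defs.next G q) v).
  by elim: k {IHk} => //= k IHk; apply: next_adj.
have dG : (q, iter k (Defs.next G q) v) \in darts G by rewrite inE.
have [eq1 eq2] := st _ dG erefl.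
rewrite IHk -eq1 -eq2 /face_perm mem_reverse dG.
by [].
Qed.

Lemma steady_path (V : eqType) (b : 'I_n * 'I_n -> V) x p v w :
  path (adj G) x p -> {in x :: p, forall q, steady b q} ->
  adj G x v -> adj G (last x p) w -> b (x, v) = b (last x p, w).
Proof.
elim: p x v => [|y p IHp] x v /=; first by move=> _ st; apply: steady_at (st x (mem_head _ _)).
move=> /andP[xy yp] st xv lw; have stx := st x (mem_head _ _).
have xyG : (x, y) \in darts G by rewrite inE.
rewrite (steady_at stx xv xy) -(stx _ xyG erefl).1.
apply: IHp => // [q qp|]; last by rewrite adj_sym.
by apply: st; rewrite inE qp orbT.
Qed.

End Faces.

(** * Circulations and the Jordan curve property *)

Section LinearAlgebra.
Import GRing.Theory Num.Theory.
Local Open Scope ring_scope.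

Lemma rank_constant_kernel (F : fieldType) m p (A : 'M[F]_(m, p)) :
  (forall a : 'rV_m, a *m A = 0 -> forall i j, a 0 i = a 0 j) ->
  (m <= (\rank A).+1)%N.
Proof.
move=> constA; have : (\rank (kermx A) <= 1)%N.
  apply: leq_trans (rank_leq_row (const_mx 1 : 'rV[F]_m)); apply: mxrankS.
  apply/row_subP=> i; apply/sub_rVP; exists (row i (kermx A) 0 i).
  apply/rowP=> j; rewrite !mxE mulr1.
  have := constA (row i (kermx A)); rewrite -row_mul mulmx_ker row0.
  by move/(_ erefl j i); rewrite !mxE.
by rewrite mxrank_ker leq_subLR addn1.
Qed.

(** The ranks are at least [m - 1] and [q - 1], so the kernel of [B] has dimension at most
    [p - q + 1 <= m - 1], and the image of [A] fills it. The inequality on [p] is Euler's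
    formula. *)
Lemma exact_of_ranks (F : fieldType) m p q (A : 'M[F]_(m, p)) (B : 'M_(p, q)) :
  A *m B = 0 -> (p.+2 <= m + q)%N ->
  (forall a : 'rV_m, a *m A = 0 -> forall i j, a 0 i = a 0 j) ->
  (forall b : 'rV_q, b *m B^T = 0 -> forall i j, b 0 i = b 0 j) ->
  forall x : 'rV_p, x *m B = 0 -> exists a, x = a *m A.
Proof.
move=> AB0 le_p constA constB x xB0; apply/submxP.
have rankA := rank_constant_kernel constA.
have := rank_constant_kernel constB; rewrite mxrank_tr => rankB.
have sub_ker : (A <= kermx B)%MS by apply/sub_kermxP.
suff sup : (kermx B <= A)%MS by apply: submx_trans sup; apply/sub_kermxP.
rewrite -(geq_leqif (mxrank_leqif_sup sub_ker)) mxrank_ker.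
by lia.
Qed.

Variables (n : nat) (G : embedded_graph n).
Hypotheses (G_conn : connected_graph G) (G_planar : planar_embedding G).
Implicit Types d e : 'I_n * 'I_n.

Definition edges : {set 'I_n * 'I_n} := [set d in darts G | (d.1 < d.2)%N].

Lemma sum_darts (V : zmodType) (f : 'I_n * 'I_n -> V) :
  \sum_(d in darts G) f d = \sum_(e in edges) (f e + f (reverse e)).
Proof.
rewrite big_split /= (bigID (fun d : 'I_n * 'I_n => d.1 < d.2)%N) /=.
congr (_ + _); first by apply: eq_bigl => d; rewrite !inE.
rewrite (reindex_inj (can_inj (@reverseK n))) /=; apply: eq_bigl => d.
rewrite mem_reverse !inE /= -leqNgt leq_eqVlt andb_orr.
by case: eqP => [/val_inj->|_]; rewrite ?adj_irr ?andbF.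
Qed.

Lemma card_edges : #|darts G| = (#|edges|).*2.
Proof.
have := sum_darts (fun _ => 1 : int).
rewrite big_split /= !sumr_const -mulrnDr addnn.
by move/eqP; rewrite !natz eqz_nat => /eqP.
Qed.

Definition boundary d (v : 'I_n) : rat := (d.2 == v)%:R - (d.1 == v)%:R.

Lemma boundary_reverse d v : boundary (reverse d) v = - boundary d v.
Proof. by rewrite /boundary opprB. Qed.

Definition face (i : 'I_#|faces G|) : {set 'I_n * 'I_n} := enum_val i.
Definition edge (j : 'I_#|edges|) : 'I_n * 'I_n := enum_val j.

Lemma sum_edge (V : nmodType) (f : 'I_n * 'I_n -> V) :
  \sum_j f (edge j) = \sum_(e in edges) f e.
Proof. exact/esym/big_enum_val. Qed.

(** The cellular boundary map, with edges oriented towards the larger endpoint. An edge with the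
    same face on both sides cancels. *)
Definition face_edge : 'M[rat]_(#|faces G|, #|edges|) :=
  \matrix_(i, j) ((edge j \in face i)%:R - (reverse (edge j) \in face i)%:R).

Definition edge_vertex : 'M[rat]_(#|edges|, n) :=
  \matrix_(j, v) boundary (edge j) v.

Lemma face_in i : face i \in faces G.
Proof. exact: enum_valP. Qed.

Definition dart_value (a : 'rV[rat]_#|faces G|) d : rat :=
  \sum_i a 0 i * (d \in face i)%:R.

Lemma dart_value_perm a d : dart_value a (face_perm G d) = dart_value a d.
Proof. by apply: eq_bigr => i _; rewrite mem_face_perm ?face_in. Qed.

Lemma dart_valueE a i d : d \in face i -> dart_value a d = a 0 i.
Proof.
move=> di; rewrite /dart_value (bigD1 i) //= di mulr1 big1 ?addr0 // => j neq_ij.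
case dj: (d \in face j); last by rewrite mulr0.
have [_ eq_i] := facesP (face_in i) di.
have [_ eq_j] := facesP (face_in j) dj.
by case/eqP: neq_ij; apply/enum_val_inj/(etrans eq_j (esym eq_i)).
Qed.

Lemma mulmx_face_edge a j : (a *m face_edge) 0 j =
  dart_value a (edge j) - dart_value a (reverse (edge j)).
Proof.
rewrite mxE /dart_value -sumrB; apply: eq_bigr => i _.
by rewrite mxE mulrBr.
Qed.

Lemma dart_of_edges (P : 'I_n * 'I_n -> Prop) :
  (forall j : 'I_#|edges|, P (edge j) /\ P (reverse (edge j))) ->
  forall d, d \in darts G -> P d.
Proof.
move=> Pe; have Pedge e : e \in edges -> P e /\ P (reverse e).
  by move=> eE; rewrite -(enum_rankK_in eE eE).
move=> d dG; case: (ltngtP d.1 d.2) => [lt_d|gt_d|/val_inj eq_d].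
- by apply: (Pedge d _).1; rewrite inE dG.
- rewrite -[d]reverseK; apply: (Pedge (reverse d) _).2.
  by rewrite inE mem_reverse dG.
- by move: dG; rewrite inE eq_d adj_irr.
Qed.

Lemma steady_connected (V : eqType) (b : 'I_n * 'I_n -> V) :
  (forall q, steady G b q) -> {in darts G &, forall d e, b d = b e}.
Proof.
move=> st [x v] [y w]; rewrite !inE /= => xv yw.
have /connectP[p Gp lp] := G_conn x y; rewrite lp in yw *.
by apply: steady_path yw => // q _; apply: st.
Qed.

(** Connectedness of the dual graph: a function in the kernel agrees on the two sides of every
    edge. *)
Lemma face_edge_kernel (a : 'rV[rat]_#|faces G|) :
  a *m face_edge = 0 -> forall i j, a 0 i = a 0 j.
Proof.
move=> aM0; pose A := dart_value a.
have A_rev d : d \in darts G -> A (reverse d) = A d.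
  move: d; apply: dart_of_edges => j; rewrite reverseK.
  have /eqP := mulmx_face_edge a j; rewrite aM0 mxE eq_sym subr_eq0 => /eqP.
  by rewrite /A => ->.
have A_const : {in darts G &, forall d e, A d = A e}.
  apply: steady_connected => q d dG _.
  by split; [apply: A_rev | apply: dart_value_perm].
have ex_dart (i : 'I_#|faces G|) : exists2 d, d \in darts G & d \in face i.
  have /imsetP[d dG ->] := face_in i.
  by exists d; rewrite // inE connect0.
move=> i j; have [d dG di] := ex_dart i; have [e eG ej] := ex_dart j.
by rewrite -(dart_valueE a di) -(dart_valueE a ej); apply: A_const.
Qed.

Lemma edge_vertex_kernel (b : 'rV[rat]_n) :
  b *m edge_vertex^T = 0 -> forall i j, b 0 i = b 0 j.
Proof.
move=> bB0.
have b_adj d : d \in darts G -> b 0 d.1 = b 0 d.2.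
  move: d; apply: dart_of_edges => j /=; suff -> : b 0 (edge j).1 = b 0 (edge j).2 by [].
  apply/eqP; rewrite eq_sym -subr_eq0; apply/eqP.
  have <- : (b *m edge_vertex^T) 0 j = 0 by rewrite bB0 mxE.
  rewrite mxE (eq_bigr (fun v => b 0 v * ((edge j).2 == v)%:R -
                                 b 0 v * ((edge j).1 == v)%:R)).
    have pick u : \sum_v b 0 v * (u == v)%:R = b 0 u.
      rewrite (bigD1 u) //= eqxx mulr1 big1 ?addr0 // => v.
      by rewrite eq_sym => /negPf->; rewrite mulr0.
    by rewrite sumrB !pick.
  by move=> v _; rewrite !mxE mulrBr.
move=> i j; have /connectP[p Gp ->] := G_conn i j.
elim: p i Gp => //= k p IHp i /andP[ik kp]; rewrite -(IHp k kp).
by apply: (b_adj (i, k)); rewrite inE.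
Qed.

(** A boundary has no boundary: the head of each dart of a face is the tail of its successor, so
    reindexing by [face_perm] cancels the sum. *)
Lemma face_edge_vertex : face_edge *m edge_vertex = 0.
Proof.
apply/matrixP=> i v; rewrite mxE [RHS]mxE; set X := face i.
have XF : X \in faces G := face_in i.
pose f d := (d \in X)%:R * boundary d v.
transitivity (\sum_j (f (edge j) + f (reverse (edge j)))).
  by apply: eq_bigr => j _; rewrite !mxE mulrBl /f boundary_reverse mulrN.
rewrite (sum_edge (fun e => f e + f (reverse e))) -sum_darts /f.
rewrite (eq_bigr (fun d => (d \in X)%:R * (d.2 == v)%:R -
                           (d \in X)%:R * (d.1 == v)%:R)); last first.
  by move=> d _; rewrite -mulrBr.
rewrite sumrB [X in _ - X](reindex_inj (@face_perm_inj n G)) /=.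
apply/eqP; rewrite subr_eq0; apply/eqP; apply: eq_big => d.
  by rewrite face_perm_dart.
by move=> dG; rewrite mem_face_perm // /face_perm dG.
Qed.

(* Euler's formula makes the boundary complex exact in the middle, so a
   circulation [y] is a combination of facial walks. *)
Lemma circulation_potential (y : 'I_n * 'I_n -> rat) d0 : d0 \in darts G ->
  (forall v, \sum_(d in darts G) y d * boundary d v = 0) ->
  exists A : 'I_n * 'I_n -> rat, (forall d, A (face_perm G d) = A d) /\
    {in darts G, forall d, A d - A (reverse d) = y d - y (reverse d)}.
Proof.
move=> d0G y_circ.
pose x : 'rV[rat]_#|edges| := \row_j (y (edge j) - y (reverse (edge j))).
have xB0 : x *m edge_vertex = 0.
  apply/rowP=> v; rewrite mxE [RHS]mxE -[RHS](y_circ v) sum_darts -sum_edge.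
  by apply: eq_bigr => j _; rewrite !mxE mulrBl boundary_reverse mulrN.
(* The dart [d0] excludes the one-vertex graph, where [num_faces] exceeds [#|faces G|]. *)
have euler : (#|edges|.+2 <= #|faces G| + n)%N.
  have : (0 < #|faces G|)%N.
    by apply/card_gt0P; exists [set e | fconnect (face_perm G) d0 e];
       apply: face_in_faces.
  move: G_planar; rewrite /planar_embedding /num_faces card_edges doubleK.
  by lia.
have [a def_x] := exact_of_ranks face_edge_vertex euler face_edge_kernel
                    edge_vertex_kernel xB0.
exists (dart_value a); split; first exact: dart_value_perm.
apply: dart_of_edges => j; rewrite reverseK.
have eq_j : dart_value a (edge j) - dart_value a (reverse (edge j)) =
    y (edge j) - y (reverse (edge j)).
  by rewrite -mulmx_face_edge -def_x mxE.
by split=> //; rewrite -opprB eq_j opprB.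
Qed.

Definition count_dart (s : seq ('I_n * 'I_n)) d : rat := (count_mem d s)%:R.

Lemma sum_count_dart s f : all [in darts G] s ->
  \sum_(d in darts G) count_dart s d * f d = \sum_(d <- s) f d.
Proof.
elim: s => [_|e s IHs /= /andP[eG /IHs def_s]].
  by rewrite big_nil big1 // => d _; rewrite mul0r.
rewrite big_cons -def_s (eq_bigr (fun d => (e == d)%:R * f d + count_dart s d * f d)).
  rewrite big_split; congr (_ + _).
  rewrite (bigD1 e) //= eqxx mul1r big1 ?addr0 // => d /andP[_].
  by rewrite eq_sym => /negPf->; rewrite mul0r.
by move=> d _; rewrite -mulrDl -natrD.
Qed.

Definition path_darts (x : 'I_n) (p : seq 'I_n) := zip (belast x p) p.

Lemma path_darts_sub x p : path (adj G) x p -> all [in darts G] (path_darts x p).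
Proof.
elim: p x => //= y p IHp x /andP[xy /IHp->].
by rewrite inE /= xy.
Qed.

Lemma sum_path_darts x p v :
  \sum_(d <- path_darts x p) boundary d v = (last x p == v)%:R - (x == v)%:R.
Proof.
elim: p x => [|y p IHp] x; first by rewrite big_nil subrr.
by rewrite big_cons IHp /boundary /= addrC addrA subrK.
Qed.

Lemma mem_path_darts x p d :
  d \in path_darts x p -> d.1 \in x :: p /\ d.2 \in x :: p.
Proof.
elim: p x => //= y p IHp x; rewrite inE => /predU1P[->|/IHp[d1 d2]].
  by rewrite !inE !eqxx orbT.
by rewrite ![_ \in x :: _]in_cons d1 d2 !orbT.
Qed.

Lemma sum_traject d m v : d \in darts G ->
  \sum_(e <- traject (face_perm G) d m) boundary e v =
  ((iter m (face_perm G) d).1 == v)%:R - (d.1 == v)%:R.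
Proof.
elim: m d => [|m IHm] d dG; first by rewrite big_nil subrr.
rewrite trajectS big_cons IHm ?face_perm_dart // -iterSr.
have -> : (face_perm G d).1 = d.2 by rewrite /face_perm dG.
by rewrite /boundary addrC addrA subrK.
Qed.

(** Shifting the arc by one dart trades its first dart for the one after its last; neither of these
    starts at the vertex considered. *)
Lemma count_traject d m e : e \in darts G ->
  (face_perm G e).1 != d.1 -> (face_perm G e).1 != (iter m (face_perm G) d).1 ->
  count_dart (traject (face_perm G) d m) (face_perm G e) =
  count_dart (traject (face_perm G) d m) e.
Proof.
move=> eG neq_d neq_m; rewrite /count_dart; congr _%:R.
have : count_mem (face_perm G e) (traject (face_perm G) d m.+1) =
       count_mem (face_perm G e) (traject (face_perm G) d m).
  rewrite trajectSr -cats1 count_cat /= addn0.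
  by case: eqP => [eq_m|]; rewrite ?addn0 // -eq_m eqxx in neq_m *.
move=> <-; rewrite trajectS /=.
case: eqP => [eq_d|_]; first by rewrite -eq_d eqxx in neq_d.
rewrite add0n; elim: m d {neq_d neq_m} => //= m IHm d.
by rewrite IHm (inj_eq (@face_perm_inj n G)).
Qed.

(* For disjoint paths, the circulation "path minus facial arc" has a potential
   A; adding the indicator of the arc to A gives a function that only changes
   across the first path and at the ends of the arc.  So it is constant along
   the second path, which nevertheless joins the arc to its complement. *)
Lemma face_crossing d (i1 i2 i3 i4 : nat) : d \in darts G ->
    (i1 <= i2)%N -> (i2 <= i3)%N -> (i3 <= i4)%N ->
    (i4 < fingraph.order (face_perm G) d)%N ->
  let w i := (iter i (face_perm G) d).1 in
  crossing G (w i1) (w i2) (w i3) (w i4).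
Proof.
move=> dG le12 le23 le34 lt4 w p q Gp lp Gq lq.
case: (pickP (fun y => (y \in w i1 :: p) && (y \in w i2 :: q))) => [y /andP[]|disj].
  by exists y.
have share y : y \in w i1 :: p -> y \in w i2 :: q -> False.
  by move=> yp yq; have := disj y; rewrite yp yq.
pose D i := iter i (face_perm G) d.
have DG i : D i \in darts G by apply: iter_face_perm_dart.
pose s1 := path_darts (w i1) p.
pose s2 := traject (face_perm G) (D i1) (i3 - i1)%N.
have D3 : iter (i3 - i1)%N (face_perm G) (D i1) = D i3.
  by rewrite -iterD subnK // (leq_trans le12).
have s2G : all [in darts G] s2.
  by apply/allP=> e /trajectP[i _ ->]; apply: iter_face_perm_dart.
pose y e := count_dart s1 e - count_dart s2 e.
have [v|A [A_perm A_rev]] := @circulation_potential y d dG.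
  rewrite (eq_bigr (fun e => count_dart s1 e * boundary e v -
                             count_dart s2 e * boundary e v)).
    rewrite sumrB !sum_count_dart ?path_darts_sub //.
    by rewrite sum_path_darts sum_traject // D3 lp subrr.
  by move=> e _; rewrite mulrBl.
pose b e := A e + count_dart s2 e.
have st z : z \in w i2 :: q -> steady G b z.
  move=> zq e eG def_z; split.
    have s1_0 e' : e'.1 = z \/ e'.2 = z -> count_dart s1 e' = 0.
      move=> def_z'; rewrite /count_dart.
      have /count_memPn-> // : e' \notin s1.
      apply/negP=> /mem_path_darts[e1 e2].
      by case: def_z' => def_z'; apply: (share z) => //; rewrite -def_z'.
    have := A_rev e eG; rewrite /y !s1_0; [|by right|by left].
    rewrite !sub0r /b => /eqP; rewrite subr_eq => /eqP->.
    by rewrite opprK [RHS]addrC -(addrA (- _)) addNKr addrC.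
  have revG : reverse e \in darts G by rewrite mem_reverse.
  have def_z' : (face_perm G (reverse e)).1 = z by rewrite /face_perm revG.
  rewrite /b A_perm count_traject // def_z' ?D3; apply/eqP=> eq_z.
    by apply: (share z); rewrite // eq_z mem_head.
  by apply: (share z); rewrite // eq_z -[_.1]/(w i3) -lp mem_last.
have A_iter i : A (D i) = A d by elim: i => //= i <-; apply: A_perm.
have DE i : D i = (w i, (D i).2) by rewrite /w -/(D i); case: (D i).
have w_adj i : adj G (w i) (D i).2 by have := DG i; rewrite inE.
(* [b] agrees on the darts at [i2] and [i4], but the half-open arc from [i1] to [i3] misses the
   latter, as no dart repeats within one turn. *)
have := steady_path Gq st (w_adj i2); rewrite lq => /(_ _ (w_adj i4)).
rewrite -!DE /b !A_iter => /addrI.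
have -> : count_dart s2 (D i4) = 0.
  rewrite /count_dart; have /count_memPn-> // : D i4 \notin s2.
  apply/negP=> /trajectP[i lt_i]; rewrite -iterD => eq_D.
  have lt_ord : (i + i1 < fingraph.order (face_perm G) d)%N by lia.
  have := findex_iter lt_ord; rewrite -eq_D findex_iter //.
  by lia.
(* For [i2 = i3] the half-open arc need not contain the dart at [i2], but then the two walks share
   this vertex. *)
have [eq23 | neq23] := eqVneq i2 i3.
  by case: (share (w i2)); rewrite ?mem_head // eq23 -lp mem_last.
move/eqP; rewrite pnatr_eq0 => /eqP/count_memPn/negP[].
apply/trajectP; exists (i2 - i1)%N; first by lia.
by rewrite -iterD subnK.
Qed.

End LinearAlgebra.

(** * Compression *)

Section FacialSegment.
Variables (n : nat) (G : embedded_graph n).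
Hypotheses (G_conn : connected_graph G) (G_planar : planar_embedding G).
Variables (d : 'I_n * 'I_n) (m : nat).
Hypotheses (dG : d \in darts G) (m_gt0 : 0 < m)
  (le_m : m <= fingraph.order (face_perm G) d).

Definition walk (i : nat) : 'I_n := (iter i (face_perm G) d).1.

Lemma walk_adj i : adj G (walk i) (walk i.+1).
Proof.
have iG := iter_face_perm_dart i dG.
by move: (iG); rewrite inE /walk iterS /face_perm iG.
Qed.

(* For consecutive vertices a, b of the walk, it is impossible that b occurs
   earlier and a occurs later, as b, a, b, a would be an alternation.  So each
   step leaves a vertex for the last time or reaches one for the first time. *)
Lemma walk_length : m <= 2 * #|[set walk i | i : 'I_m]| + 1.
Proof.
set S := [set walk i | i : 'I_m].
pose last_at := [set i : 'I_m.-1 | [forall j : 'I_m, (i < j) ==> (walk j != walk i)]].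
pose first_at :=
  [set i : 'I_m.-1 | [forall j : 'I_m, (j <= i) ==> (walk j != walk i.+1)]].
have walkS i : i < m -> walk i \in S.
  by move=> lt_i; apply/imsetP; exists (Ordinal lt_i).
have le_last : #|last_at| <= #|S|.
  rewrite -(card_in_imset (f := fun i : 'I_m.-1 => walk i)).
    apply/subset_leq_card/subsetP=> _ /imsetP[i _ ->]; apply: walkS.
    by have := ltn_ord i; lia.
  have lt_walk (i j : 'I_m.-1) : i \in last_at -> i < j -> walk i <> walk j.
    rewrite inE => /forallP last_i lt_ij eq_w.
    have lt_j : j < m by have := ltn_ord j; lia.
    by have /= := last_i (Ordinal lt_j); rewrite lt_ij eq_w eqxx.
  move=> i j iL jL eq_w; apply: val_inj => /=; case: (ltngtP i j) => // lt_ij.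
    by case: (lt_walk i j).
  by case: (lt_walk j i).
have le_first : #|first_at| <= #|S|.
  rewrite -(card_in_imset (f := fun i : 'I_m.-1 => walk i.+1)).
    apply/subset_leq_card/subsetP=> _ /imsetP[i _ ->]; apply: walkS.
    by have := ltn_ord i; lia.
  have lt_walk (i j : 'I_m.-1) : j \in first_at -> i < j -> walk i.+1 <> walk j.+1.
    rewrite inE => /forallP first_j lt_ij eq_w.
    have lt_i : i.+1 < m by have := ltn_ord i; lia.
    by have /= := first_j (Ordinal lt_i); rewrite lt_ij eq_w eqxx.
  move=> i j iL jL eq_w; apply: val_inj => /=; case: (ltngtP i j) => // lt_ij.
    by case: (lt_walk i j).
  by case: (lt_walk j i).
suff cover : [set: 'I_m.-1] \subset last_at :|: first_at.
  have := leq_trans (subset_leq_card cover) (leq_card_setU _ _).1.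
  rewrite cardsT card_ord => /leq_trans/(_ (leq_add le_last le_first)).
  by move: #|S|; lia.
apply/subsetP=> i _; rewrite !inE; apply/orP.
case: (boolP [forall j : 'I_m, (i < j) ==> (walk j != walk i)]); first by left.
rewrite negb_forall => /existsP[j]; rewrite negb_imply negbK => /andP[lt_ij /eqP eq_j].
right; apply/forallP=> l; apply/implyP=> le_li; apply/eqP=> eq_l.
have lt_j := ltn_ord j.
(* Both connecting walks are empty, so crossing identifies two adjacent vertices. *)
have [y] := @face_crossing n G G_conn G_planar d l i i.+1 j dG le_li (leqnSn i)
  lt_ij (leq_trans lt_j le_m) [::] [::] isT eq_l isT (esym eq_j).
rewrite !inE -/(walk l) -/(walk i) eq_l => /eqP-> /eqP eq_w.
by have := walk_adj i; rewrite eq_w adj_irr.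
Qed.

(* The segment, extended to all of nat by repeating its ends, and starting at
   position [off]. *)
Definition clamp (off q : nat) : 'I_n := walk (minn (q - off) m.-1).

Lemma clamp_crossing off j1 j2 j3 j4 : j1 <= j2 -> j2 <= j3 -> j3 <= j4 ->
  crossing G (clamp off j1) (clamp off j2) (clamp off j3) (clamp off j4).
Proof. by move=> le12 le23 le34; apply: face_crossing => //; lia. Qed.

Lemma clamp_step off q :
  clamp off q = clamp off q.+1 \/ adj G (clamp off q) (clamp off q.+1).
Proof.
rewrite /clamp.
have [->|->] : minn (q.+1 - off) m.-1 = minn (q - off) m.-1 \/
               minn (q.+1 - off) m.-1 = (minn (q - off) m.-1).+1 by lia.
  by left.
by right; apply: walk_adj.
Qed.

Lemma dist_clamp_step off q t :
  dist G (clamp off q) t <= (dist G (clamp off q.+1) t).+1 /\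
  dist G (clamp off q.+1) t <= (dist G (clamp off q) t).+1.
Proof.
have [<-|qq] := clamp_step off q; first by lia.
by split; apply: dist_adj; rewrite // adj_sym.
Qed.

Lemma clamp_no_alternation off u v i1 i2 i3 i4 :
  i1 < i2 -> i2 < i3 -> i3 < i4 ->
  ~~ [&& up G (clamp off) u v i1, up G (clamp off) v u i2,
         up G (clamp off) u v i3 & up G (clamp off) v u i4].
Proof. by apply: crossing_no_alternation => // *; apply: clamp_crossing. Qed.

End FacialSegment.

(** The Jordan property concerns a single turn around the face; a longer segment meets no further
    vertices. *)
Lemma consecutive_walk n (G : embedded_graph n) (S : {set 'I_n}) d k :
  d \in darts G -> S = [set (iter i (face_step G) d).1 | i : 'I_k] ->
  S = set0 \/ exists m, [/\ 0 < m, m <= fingraph.order (face_perm G) d &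
    S = [set walk G d i | i : 'I_m]].
Proof.
move=> dG ->; case: k => [|k].
  by left; apply/setP=> v; rewrite inE; apply/imsetP=> -[[]].
right; exists (minn k.+1 (fingraph.order (face_perm G) d)).
split; [by rewrite leq_min order_gt0 | exact: geq_minr |].
apply/setP=> v; apply/imsetP/imsetP => -[i _ ->].
  rewrite iter_face_step //; have [lt_i|ge_i] := ltnP i (fingraph.order (face_perm G) d).
    have lt_min : i < minn k.+1 (fingraph.order (face_perm G) d).
      by rewrite leq_min ltn_ord.
    by exists (Ordinal lt_min).
  have con := fconnect_iter (face_perm G) i d.
  have lt_f : findex (face_perm G) d (iter i (face_perm G) d) <
              minn k.+1 (fingraph.order (face_perm G) d).
    have lt_f := findex_max con; rewrite leq_min lt_f andbT.
    by rewrite (leq_trans lt_f) // (leq_trans ge_i) // ltnW.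
  by exists (Ordinal lt_f); rewrite // /walk iter_findex.
have lt_i : i < k.+1 by rewrite (leq_trans (ltn_ord i)) ?geq_minl.
by exists (Ordinal lt_i); rewrite // iter_face_step.
Qed.

(** The root dominates: 11 is the least integer [c] with [64 + 2 c <= 8 c]. *)
Lemma tree_size_cubic M j :
  tree_size M (fun i => M * (8 * 8 ^ i)) j <= 11 * M * 8 ^ j.
Proof.
elim: j => [|j IHj] /=; first by lia.
rewrite expnS; move: (8 ^ j) IHj => x; nia.
Qed.

(** Constants: [m <= 3 |S|] gives [2 ^ j <= 6 |S|], and [11 (D + 1) <= 22 D]. Numbers fit in [17 L]
    digits, [13 L] for [8 + 22 * 6 ^ 3] and [4 L] for [n ^ 4]; then [8 * 17 L + 10 <= 146 L]. The
    [.+1] pays for the rules of sources and targets. *)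
Lemma segment_string n (G : embedded_graph n) (S T : {set 'I_n}) d m :
    connected_graph G -> planar_embedding G -> d \in darts G -> 0 < m ->
    m <= fingraph.order (face_perm G) d -> S = [set walk G d i | i : 'I_m] ->
  let x := instance_data G S T in
  exists2 str, encodes x str &
    size str <= 146 * (22 * 6 ^ 3).+1 * (trunc_log 2 n).+1 *
                (#|S| ^ 3 * diameter G + #|T|).
Proof.
move=> conn planar dG m_gt0 le_m def_S x.
pose dd := data_dist x; pose D := diameter G; pose L := (trunc_log 2 n).+1.
pose W q := val (clamp G d m n.*2 q).
pose j := up_log 2 m.
have ddE q (t : 'I_n) : dd (W q) (val t) = dist G (clamp G d m n.*2 q) t.
  by rewrite /dd /W data_dist_correct.
have n_gt0 : 0 < n by apply: leq_ltn_trans (ltn_ord d.1).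
(* Positivity absorbs [D + 1] into [2 D] and [|S|] into [|S| ^ 3 * D]. *)
have D_gt0 : 0 < D.
  apply: leq_trans (dist_leq_diameter G d.1 d.2); rewrite lt0n; apply/negP=> /eqP d0.
  have [p [_ lp]] := shortest_path conn d.1 d.2; rewrite d0 => /size0nil p0.
  by move: dG; rewrite inE -lp p0 adj_irr.
have lt_D : D < n.
  by rewrite -(prednK n_gt0) ltnS; apply/bigmax_leqP=> u _; apply/bigmax_leqP=> v _;
     rewrite -ltnS prednK // dist_ltn.
have S_gt0 : 0 < #|S|.
  by rewrite def_S; apply/card_gt0P; exists (walk G d (Ordinal m_gt0)); apply: imset_f.
have leSn : #|S| <= n by rewrite -[leqRHS]card_ord max_card.
have le_mS : m <= 3 * #|S|.
  by have := walk_length conn planar dG m_gt0 le_m; rewrite -def_S; move: #|S| S_gt0; lia.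
have [ge_m le_2j] : m <= 2 ^ j /\ 2 ^ j <= 6 * #|S|.
  have [m_le1 | m_gt1] := leqP m 1.
    have m1 : m = 1 by lia.
    by rewrite /j m1 muln_gt0 S_gt0.
  have /andP[lt_j le_j] := up_log_bounds (isT : 1 < 2) m_gt1.
  split=> //; move: lt_j; rewrite -/j; move: #|S| S_gt0 le_mS => s s_gt0 le_ms.
  by case: (j) => [|j'] /=; rewrite ?expnS; lia.
pose cnt i := D.+1 * (8 * 8 ^ i).
have tree_le : tree_size D.+1 cnt j <= 22 * 6 ^ 3 * (#|S| ^ 3 * D).
  apply: leq_trans (tree_size_cubic _ _) _.
  have -> : 8 ^ j = (2 ^ j) ^ 3 by rewrite -expnM mulnC expnM.
  have le_cube : (2 ^ j) ^ 3 <= 6 ^ 3 * #|S| ^ 3 by rewrite -expnMn leq_exp2r.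
  apply: leq_trans (leq_mul (leqnn _) le_cube) _.
  by move: (6 ^ 3) (#|S| ^ 3) => a b; nia.
have lt_w : n.*2 + 2 ^ j + tree_size D.+1 cnt j < 2 ^ (17 * L).
  have lt_n4 : n ^ 4 < 2 ^ (4 * L).
    have lt_n : n < 2 ^ L by apply: trunc_log_ltn.
    by rewrite [4 * L]mulnC expnM ltn_exp2r.
  have le_n4 : #|S| ^ 3 * D <= n ^ 4.
    by rewrite (expnSr n) leq_mul ?leq_exp2r // ltnW.
  have tree_le_n := leq_trans tree_le (leq_mul (leqnn (22 * 6 ^ 3)) le_n4).
  have le_n : n <= n ^ 4 by rewrite -{1}(expn1 n) leq_pexp2l.
  have le_13 : 8 + 22 * 6 ^ 3 <= 2 ^ (13 * L).
    by apply: (@leq_trans (2 ^ 13)); rewrite ?leq_pexp2l //; rewrite /L; lia.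
  have -> : 17 * L = 13 * L + 4 * L by rewrite -mulnDl.
  rewrite expnD; apply: (@leq_trans ((8 + 22 * 6 ^ 3) * (n ^ 4).+1)).
    apply: (@leq_ltn_trans ((8 + 22 * 6 ^ 3) * n ^ 4)).
      rewrite mulnDl leq_add ?tree_le_n //.
      by move: (2 ^ j) (n ^ 4) (#|S|) leSn le_2j le_n; lia.
    by rewrite ltn_mul2l ltnS leqnn.
  by rewrite leq_mul.
have mem_T t : t \in x.2 -> exists2 t' : 'I_n, t = val t' & t' \in T.
  by case/mapP=> t'; rewrite mem_enum => t'T ->; exists t'.
have [||||||||str [size_str strP]] :=
    @string_exists x.1.2 x.2 dd W n D.+1 j (17 * L) cnt _ _ _ _ _ _ _ _ lt_w.
- by rewrite map_inj_uniq ?enum_uniq //; apply: val_inj.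
- by rewrite map_inj_uniq ?enum_uniq //; apply: val_inj.
- by move=> _ /mapP[s _ ->]; apply: ltn_ord.
- by move=> _ /mapP[s _ ->]; apply: ltn_ord.
- move=> _ /mapP[s + ->]; rewrite mem_enum def_S => /imsetP[i _ ->].
  apply/mapP; exists (n.*2 + i).
    by rewrite mem_iota leq_addr ltn_add2l (leq_trans (ltn_ord i)).
  by rewrite /W /clamp addKn; congr (val (walk G d _)); have := ltn_ord i; lia.
- by lia.
- by move=> q _ /mem_T[t -> _]; rewrite ddE ltnS dist_leq_diameter.
- move=> lo i; rewrite -(prednK (expn_gt0 2 i)).
  apply: leq_trans (@profile_count x.2 D.+1 (dd \o W) _ _ _ lo _) _.
  + by move=> q _ /mem_T[t -> _]; rewrite /= ddE ltnS dist_leq_diameter.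
  + by move=> q _ /mem_T[t -> _]; rewrite /= !ddE; apply: dist_clamp_step.
  + move=> _ _ /mem_T[t -> _] /mem_T[u -> _] i1 i2 i3 i4 lt12 lt23 lt34.
    rewrite /steeper /= !ddE.
    exact: (clamp_no_alternation conn planar dG m_gt0 le_m n.*2 t u lt12 lt23 lt34).
  rewrite leq_mul //.
  have -> : 8 * 8 ^ i = (2 * 2 ^ i) ^ 3.
    by rewrite expnMn -expnM mulnC [i * 3]mulnC expnM mulnC.
  by rewrite leq_exp2r //; have := expn_gt0 2 i; lia.
exists str.
  by apply/allP=> s sS; apply/allP=> t tT; rewrite strP.
apply: leq_trans size_str _.
rewrite !size_map -!cardE -/D -/L.
move: (22 * 6 ^ 3) tree_le => K tree_le.
apply: (@leq_trans (146 * L * (K.+1 * (#|S| ^ 3 * D + #|T|)))).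
  apply: leq_mul; first by rewrite /L; lia.
  have leSX : #|S| <= #|S| ^ 3 * D.
    by rewrite -[leqLHS]muln1 leq_mul // -{1}(expn1 #|S|) leq_pexp2l.
  rewrite mulSn mulnDr; apply: leq_add; first by rewrite leq_add2r.
  exact: leq_trans tree_le (leq_addr _ _).
by rewrite -!mulnA leq_mul2l [L * _]mulnCA leqnn orbT.
Qed.

Lemma encode_size n (G : embedded_graph n) (S T : {set 'I_n}) :
  connected_graph G -> planar_embedding G -> consecutive_on_face G S ->
  size (encode (instance_data G S T)) <=
    146 * (22 * 6 ^ 3).+1 * (trunc_log 2 n).+1 *
    (#|S| ^ 3 * diameter G + #|T|).
Proof.
move=> conn planar cons_S.
have trivial_string : encodes (instance_data G S T) [::] ->
    size (encode (instance_data G S T)) <=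
      146 * (22 * 6 ^ 3).+1 * (trunc_log 2 n).+1 *
      (#|S| ^ 3 * diameter G + #|T|).
  by move/encode_shortest; rewrite leqn0 => /eqP->.
case: cons_S => [[d dG [k /(consecutive_walk dG)[S0|[m [m_gt0 le_m def_S]]]]]|[v iso_v subS]].
- by apply: trivial_string; rewrite /encodes /= S0 enum_set0.
- have [str enc_str le_str] := segment_string T conn planar dG m_gt0 le_m def_S.
  exact: leq_trans (encode_shortest enc_str) le_str.
(* The only vertex is numbered 0, and the empty program returns [0 + 0]. The bound can be 0 here,
   which leaves no room for a longer string. *)
apply/trivial_string/allP=> _ /mapP[s _ ->]; apply/allP=> _ /mapP[t _ ->].
have eq_v u : u = v.
  have /connectP[[|w p] //= /andP[vw _] _] := conn v u.
  by case/negP: (iso_v w).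
have n_gt0 : 0 < n by apply: leq_ltn_trans (ltn_ord v).
by rewrite data_dist_correct // (eq_v s) (eq_v t) -(eq_v (Ordinal n_gt0)) dist0.
Qed.

(* The encoder, the decoder and the constants hidden by the soft-O bound are
   chosen once and for all, before the instance; in particular the decoder
   learns about the graph only through the bit string. *)
Theorem theorem1p2 :
  exists (encode : nat * seq (nat * nat * nat) * seq nat * seq nat -> seq bool)
         (decode : seq bool * nat * nat -> nat)
         (C c : nat),
    [/\ computable encode,
        computable decode &
        forall (n : nat) (G : embedded_graph n) (S T : {set 'I_n}),
          connected_graph G -> planar_embedding G -> consecutive_on_face G S ->
          let str := encode (instance_data G S T) in
          size str <= C * (trunc_log 2 n).+1 ^ c
                        * (#|S| ^ 3 * diameter G + #|T|)
          /\ forall s t : 'I_n, s \in S -> t \in T ->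
               decode (str, val s, val t) = dist G s t].
Proof.
exists encode, decode, (146 * (22 * 6 ^ 3).+1), 1; split.
- exact: computable_encode.
- exact: computable_decode.
move=> n G S T conn planar cons_S str; split.
  by rewrite expn1; apply: encode_size.
move=> s t sS tT; rewrite -(data_dist_correct conn S T).
have /allP/(_ (val s)) := encode_correct (instance_data G S T).
rewrite map_f ?mem_enum // => /(_ isT)/allP/(_ (val t)).
by rewrite map_f ?mem_enum // => /(_ isT)/eqP.
Qed.
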